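(* Consider the dual problem $$\min_{Z=(y,w,S)\in\mathbb{R}^e\times\mathbb{R}^d\times\mathbb{X}}\ \Psi(Z):=\delta_{\mathcal{Q}^*}(y)-\langle b,y\rangle+h^*(-w)+\theta^*(-S)\quad\text{s.t.}\quad\mathcal{A}^*y+\mathcal{F}^*w+S=C,$$ where $\theta$ is a spectral function, either $\theta=g\circ\sigma$ with $g$ proper closed convex and absolutely symmetric, or (with $\mathbb{X}=\mathbb{S}^n$) $\theta=g\circ\lambda$ with $g$ proper closed convex and symmetric. Let $\overline{Z}=(\bar y,\bar w,\overline{S})$ be an optimal solution of this problem with $\mathcal{M}_D(\overline{Z})\ne\emptyset$. Assume that: (a) $h^*$ is continuously differentiable on $\mathrm{dom}\,h^*$, which is assumed to be a nonempty open convex set, and $h^*$ is also strongly convex on any compact subset of $\mathrm{dom}\,h^*$; (b) if $\theta=g\circ\sigma$: for any $\bar v\in\partial g^*(\sigma(-\overline{S}))$, the mapping $\partial g^*$ is metrically subregular at $\sigma(-\overline{S})$ for $\bar v$; respectively, if $\theta=g\circ\lambda$: for any $\bar v\in\partial g^*(\lambda(-\overline{S}))$, the mapping $\partial g^*$ is metrically subregular at $\lambda(-\overline{S})$ for $\bar v$; (c) the collection of sets $\{\mathcal{V}_D,\mathcal{G}^1_D(\overline{X}),\mathcal{G}^2_D(\overline{X}),\mathcal{G}^3_D(\overline{X})\}$ is boundedly linearly regular for some $\overline{X}\in\mathcal{M}_D(\overline{Z})$. Then the quadratic growth condition holds at $\overline{Z}$: there exist constants $\delta_d>0$ and $\kappa_d>0$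 such that $$\Psi(Z)\ge\Psi(\overline{Z})+\kappa_d\,\mathrm{dist}^2(Z,\Omega_D)\qquad\forall\,Z\in F_D\cap\mathbb{B}_{\delta_d}(\overline{Z}).$$
   Context: Setting. $\mathbb{X}$ is either $\mathbb{R}^{n\times m}$ ($n\le m$) or the space $\mathbb{S}^n$ of real symmetric $n\times n$ matrices, with the trace inner product and the induced norm. $C\in\mathbb{X}$, $b\in\mathbb{R}^e$; $\mathcal{F}:\mathbb{X}\to\mathbb{R}^d$ and $\mathcal{A}:\mathbb{X}\to\mathbb{R}^e$ are linear with adjoints $\mathcal{F}^*,\mathcal{A}^*$; $h:\mathbb{R}^d\to(-\infty,+\infty]$ is convex and continuously differentiable on $\mathrm{dom}\,h$, which is a nonempty open convex set; $\theta:\mathbb{X}\to(-\infty,+\infty]$ is proper closed convex; $\mathcal{Q}\subseteq\mathbb{R}^e$ is a convex polyhedral cone with dual cone $\mathcal{Q}^*=\{y\mid\langle y,z\rangle\ge0\ \forall z\in\mathcal{Q}\}$; $h^*,\theta^*,g^*$ are conjugate functions; $\delta_{\mathcal{Q}^*}$ is the indicator function of $\mathcal{Q}^*$. The displayed problem is the dual of the primal problem $\min_{X\in\mathbb{X}}\ h(\mathcal{F}X)+\langle C,X\rangle+\theta(X)$ s.t. $\mathcal{A}X\in b+\mathcal{Q}$. Standing assumption: the optimal solution sets $\Omega_P$ of the primal problem and $\Omega_D$ of the dual problem are nonempty. Write $\mathbb{Z}=\mathbb{R}^e\times\mathbb{R}^d\times\mathbb{X}$ and $Z=(y,w,S)$.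 $F_D=\{Z\in\mathbb{Z}\mid\mathcal{A}^*y+\mathcal{F}^*w+S=C,\ y\in\mathcal{Q}^*\}$. $\mathbb{B}_\rho(u)$ is the closed ball of radius $\rho$ centered at $u$; $\mathrm{dist}$ is the Euclidean distance to a set (equal to $+\infty$ for the empty set). Strong convexity of $h^*$ on compact subsets of $\mathrm{dom}\,h^*$ is understood as strong convexity on every convex compact subset (the modulus may depend on the subset). Spectral functions. $\sigma(X)$ is the vector of singular values of $X\in\mathbb{X}$, and $\lambda(X)$ the vector of eigenvalues of $X\in\mathbb{S}^n$, in non-increasing order. $g:\mathbb{R}^n\to(-\infty,+\infty]$ is symmetric (resp. absolutely symmetric) if $g(Qx)=g(x)$ for all $x$ and all permutation (resp. signed permutation) matrices $Q$. Multipliers. $\mathcal{M}_D(\overline{Z})$ is the set of $\overline{X}\in\mathbb{X}$ such that $0\in\mathcal{A}\overline{X}-b+\mathcal{N}_{\mathcal{Q}^*}(\bar y)$, $0\in\mathcal{F}\overline{X}-\partial h^*(-\bar w)$, $0\in\overline{X}-\partial\theta^*(-\overline{S})$ and $C=\mathcal{A}^*\bar y+\mathcal{F}^*\bar w+\overline{S}$, where $\mathcal{N}_{\mathcal{Q}^*}$ is the normal cone of convex analysis. The sets in (c). Under (a) the $w$-component of every element of $\Omega_D$ equals $\bar w$. Then $\mathcal{V}_D:=\{Z\in\mathbb{Z}\mid\mathcal{A}^*y+\mathcal{F}^*w+S=C\}$ and, for $X\in\mathbb{X}$, $\mathcal{G}^1_D(X):=\{Z\in\mathbb{Z}\mid0\in\mathcal{A}X-b+\mathcal{N}_{\mathcal{Q}^*}(y)\}$,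 $\mathcal{G}^2_D(X):=\{Z\in\mathbb{Z}\mid w=\bar w\}$, $\mathcal{G}^3_D(X):=\{Z\in\mathbb{Z}\mid0\in S+\partial\theta(X)\}$. Bounded linear regularity. Closed convex sets $D_1,\dots,D_s$ with nonempty intersection $D$ form a boundedly linearly regular collection if for every bounded set $\mathcal{B}$ there is $\kappa>0$ such that $\mathrm{dist}(x,D)\le\kappa\max_{1\le i\le s}\mathrm{dist}(x,D_i)$ for all $x\in\mathcal{B}$. Metric subregularity. A set-valued mapping $G:\mathbb{U}\rightrightarrows\mathbb{V}$ is metrically subregular at $\bar u$ for $\bar v$ if $\bar v\in G(\bar u)$ and there exist $\delta,\varepsilon,\kappa>0$ such that $\mathrm{dist}(u,G^{-1}(\bar v))\le\kappa\,\mathrm{dist}(\bar v,G(u)\cap\mathbb{B}_\delta(\bar v))$ for all $u\in\mathbb{B}_\varepsilon(\bar u)$. *)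

(* Defs.v *)
From HB Require Import structures.
From mathcomp Require Import all_boot all_order all_algebra.
From mathcomp Require Import all_classical all_reals all_analysis.
From mathcomp Require Import ring.
From mathcomp Require complex.

Set Implicit Arguments.
Unset Strict Implicit.
Unset Printing Implicit Defensive.

Import Order.TTheory GRing.Theory Num.Theory.
Import numFieldNormedType.Exports.

Local Open Scope classical_set_scope.
Local Open Scope ring_scope.

HB.mixin Record isInnerProduct (R : realType) V of Vector R V := {
  dot : V -> V -> R;
  dotC : forall x y, dot x y = dot y x;
  dotDl : forall x y z, dot (x + y) z = dot x z + dot y z;
  dotZl : forall (a : R) x y, dot (a *: x) y = a * dot x y;
  dot_ge0 : forall x, 0 <= dot x x;
  dot_eq0 : forall x, dot x x = 0 -> x = 0 }.

#[short(type="innerType")]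
HB.structure Definition InnerProduct (R : realType) :=
  { V of Vector R V & isInnerProduct R V }.

Section instances.
Variable R : realType.

Section matrix.
Variables m n : nat.
Implicit Types A B : 'M[R]_(m, n).

Definition mxdot A B : R := \tr (A^T *m B).

Let mxdotE A B : mxdot A B = \sum_j \sum_i A i j * B i j.
Proof. by apply: eq_bigr => j _; rewrite mxE; apply: eq_bigr => i _; rewrite mxE. Qed.

Let mxdotC A B : mxdot A B = mxdot B A.
Proof. by rewrite /mxdot -mxtrace_tr trmx_mul trmxK. Qed.

Let mxdotDl A B D : mxdot (A + B) D = mxdot A D + mxdot B D.
Proof. by rewrite /mxdot linearD mulmxDl linearD. Qed.

Let mxdotZl (a : R) A B : mxdot (a *: A) B = a * mxdot A B.
Proof. by rewrite /mxdot linearZ -scalemxAl linearZ. Qed.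

Let mxdot_ge0 A : 0 <= mxdot A A.
Proof. by rewrite mxdotE; do 2![apply: sumr_ge0 => ? _]; rewrite -expr2 sqr_ge0. Qed.

Let mxdot_eq0 A : mxdot A A = 0 -> A = 0.
Proof.
rewrite mxdotE => A0; apply/matrixP => i j; rewrite mxE; apply/eqP.
rewrite -sqrf_eq0 expr2.
have ge0 k l : 0 <= A k l * A k l by rewrite -expr2 sqr_ge0.
have := psumr_eq0P (fun l _ => sumr_ge0 _ (fun k _ => ge0 k l)) A0.
by move=> /(_ j isT)/(psumr_eq0P (fun k _ => ge0 k j))/(_ i isT)/eqP.
Qed.

HB.instance Definition _ := isInnerProduct.Build R 'M[R]_(m, n)
  mxdotC mxdotDl mxdotZl mxdot_ge0 mxdot_eq0.
End matrix.

Section subspace.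
Variables (V : innerType R) (U : {vspace V}).
Implicit Types x y : subvs_of U.

Definition subdot x y : R := dot (vsval x) (vsval y).

Let subdotC x y : subdot x y = subdot y x. Proof. exact: dotC. Qed.

Let subdotDl x y z : subdot (x + y) z = subdot x z + subdot y z.
Proof. by rewrite /subdot linearD dotDl. Qed.

Let subdotZl (a : R) x y : subdot (a *: x) y = a * subdot x y.
Proof. by rewrite /subdot linearZ dotZl. Qed.

Let subdot_ge0 x : 0 <= subdot x x. Proof. exact: dot_ge0. Qed.

Let subdot_eq0 x : subdot x x = 0 -> x = 0.
Proof. by move=> /dot_eq0 x0; apply: val_inj; rewrite [LHS]x0 [RHS]linear0. Qed.

HB.instance Definition _ := isInnerProduct.Build R (subvs_of U)
  subdotC subdotDl subdotZl subdot_ge0 subdot_eq0.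
End subspace.

Section product.
Variables V W : innerType R.
Implicit Types x y : (V * W)%type.

Definition pairdot x y : R := dot x.1 y.1 + dot x.2 y.2.

Let pairdotC x y : pairdot x y = pairdot y x.
Proof. by rewrite /pairdot dotC (dotC x.2). Qed.

Let pairdotDl x y z : pairdot (x + y) z = pairdot x z + pairdot y z.
Proof. by rewrite /pairdot !dotDl addrACA. Qed.

Let pairdotZl (a : R) x y : pairdot (a *: x) y = a * pairdot x y.
Proof. by rewrite /pairdot !dotZl mulrDr. Qed.

Let pairdot_ge0 x : 0 <= pairdot x x.
Proof. by rewrite addr_ge0 ?dot_ge0. Qed.

Let pairdot_eq0 x : pairdot x x = 0 -> x = 0.
Proof.
case: x => x y /eqP; rewrite paddr_eq0 ?dot_ge0//= => /andP[/eqP x0 /eqP y0].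
by rewrite (dot_eq0 _ x0) (dot_eq0 _ y0).
Qed.

HB.instance Definition _ := isInnerProduct.Build R (V * W)%type
  pairdotC pairdotDl pairdotZl pairdot_ge0 pairdot_eq0.
End product.
End instances.

(* Matrices and pairs already carry the sup norm in the library; [euc V] is a
   copy of [V] whose norm (hence topology, balls, ...) is the one induced by
   the inner product. *)
Definition euc (R : realType) (V : innerType R) : Type := V.

Section euclidean_norm.
Variables (R : realType) (V : innerType R).
HB.instance Definition _ := InnerProduct.on (euc V).
Implicit Types x y : euc V.

Definition eucnorm x : R := Num.sqrt (dot x x).

Let dotDr x y z : dot x (y + z) = dot x y + dot x z.
Proof. by rewrite dotC dotDl dotC (dotC z). Qed.

Let dotZr (a : R) x y : dot x (a *: y) = a * dot x y.
Proof. by rewrite dotC dotZl dotC. Qed.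

Lemma cauchy_schwarz x y : dot x y ^+ 2 <= dot x x * dot y y.
Proof.
have [y0|yN0] := eqVneq (dot y y) 0.
  have -> : dot x y = 0.
    by rewrite (dot_eq0 _ y0) -(scale0r (0 : V)) dotZr mul0r.
  by rewrite y0 mulr0 expr0n.
have ygt0 : 0 < dot y y by rewrite lt_def yN0 dot_ge0.
have := dot_ge0 ((dot y y) *: x + (- dot x y) *: y).
rewrite dotDl !dotDr !dotZl !dotZr (dotC y x).
set a := dot x x; set c := dot y y; set k := dot x y => H.
suff : 0 <= c * (a * c - k ^+ 2) by rewrite pmulr_rge0// subr_ge0.
suff -> : c * (a * c - k ^+ 2) =
  c * (c * a) + c * (- k * k) + (- k * (c * k) + - k * (- k * c)) by [].
by rewrite expr2 -/c; ring.
Qed.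

Let eucnormD x y : eucnorm (x + y) <= eucnorm x + eucnorm y.
Proof.
rewrite -[leRHS]ger0_norm ?addr_ge0 ?sqrtr_ge0// -sqrtr_sqr ler_wsqrtr//.
rewrite sqrrD !sqr_sqrtr ?dot_ge0// dotDl !dotDr (dotC y x).
rewrite addrA lerD2r -addrA lerD2l -mulr2n lerMn2r/=.
apply: le_trans (ler_norm _) _; rewrite -sqrtrM ?dot_ge0//.
by rewrite -sqrtr_sqr ler_wsqrtr// cauchy_schwarz.
Qed.

Let eucnormZ (a : R) x : eucnorm (a *: x) = `|a| * eucnorm x.
Proof. by rewrite /eucnorm dotZl dotZr mulrA -expr2 sqrtrM ?sqr_ge0// sqrtr_sqr. Qed.

Let eucnorm0_eq0 x : eucnorm x = 0 -> x = 0.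
Proof.
by move=> /eqP; rewrite sqrtr_eq0 => x0; apply/dot_eq0/le_anti; rewrite x0 dot_ge0.
Qed.

HB.instance Definition _ := Lmodule_isNormed.Build R (euc V)
  eucnormD eucnormZ eucnorm0_eq0.
End euclidean_norm.

Notation "''E[' R ]_ n" := (euc 'cV[R]_n)
  (at level 0, n at level 2, format "''E[' R ]_ n").

Section convex_analysis.
Variables (R : realType) (V W : innerType R).
Local Open Scope ereal_scope.
Implicit Types (f : euc V -> \bar R) (D K : set (euc V)) (x y : euc V).

Definition edom f := [set x | f x < +oo].

Definition proper f := (forall x, f x != -oo) /\ edom f !=set0.

Definition econvex f := forall x y (t : R), (0 < t < 1)%R ->
  f (t *: x + (1 - t) *: y)%R <= t%:E * f x + (1 - t)%:E * f y.

Definition closed_convex_proper f :=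
  [/\ proper f, lower_semicontinuous f & econvex f].

Definition conjugate f y := ereal_sup [set (dot x y)%:E - f x | x in setT].

(* Empty at the points where a proper [f] is +oo. *)
Definition subdifferential f x :=
  [set v : euc V | forall z, f x + (dot v (z - x)%R)%:E <= f z].

Definition indicator D x : \bar R := if x \in D then 0 else +oo.

Definition normal_cone D x :=
  [set v : euc V | D x /\ forall z, D z -> (dot v (z - x) <= 0)%R].

Definition dual_cone D := [set y | forall z, D z -> (0 <= dot y z)%R].

Definition polyhedral_cone D := exists (k : nat) (a : 'I_k -> euc V),
  D = [set z | forall i, (dot (a i) z <= 0)%R].

(* A minimizer has a finite value: if [f] is identically +oo on [D], there is
   no minimizer. *)
Definition argmin f D :=
  [set x | [/\ D x, f x \is a fin_num & forall y, D y -> f x <= f y]].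

Definition dist x D : \bar R := ereal_inf [set `|x - y|%R%:E | y in D].

(* [f] is continuously differentiable on its effective domain, which is
   moreover required to be nonempty, open and convex; [grad] represents the
   differential through the inner product. *)
Definition C1_on_open_convex_dom f :=
  [/\ edom f !=set0, open (edom f), convex_set (edom f) &
      exists grad : euc V -> euc V, forall x, edom f x ->
        [/\ differentiable (fine \o f) x,
            forall v, 'd (fine \o f) x v = dot (grad x) v &
            {for x, continuous grad}]].

Definition strongly_convex_on f D := exists2 mu : R, (0 < mu)%R &
  forall x y (t : R), D x -> D y -> (0 <= t <= 1)%R ->
    f (t *: x + (1 - t) *: y)%R <= t%:E * f x + (1 - t)%:E * f y
      - (mu / 2 * t * (1 - t) * `|x - y| ^+ 2)%:E.

Definition strongly_convex_on_compacts f := forall K,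
  compact K -> convex_set K -> K `<=` edom f -> strongly_convex_on f K.

Definition is_adjoint (f : euc V -> euc W) (fadj : euc W -> euc V) :=
  forall x w, dot (f x) w = dot x (fadj w).

Definition boundedly_linearly_regular s (D : s.-tuple (set (euc V))) :=
  let I := \bigcap_(i in [set: 'I_s]) tnth D i in
  [/\ forall i, closed (tnth D i), forall i, convex_set (tnth D i), I !=set0 &
      forall B : set (euc V), bounded_set B -> exists2 kappa : R, (0 < kappa)%R &
        forall x, B x ->
          dist x I <= kappa%:E * \big[maxe/0]_(i < s) dist x (tnth D i)].

End convex_analysis.

Definition metrically_subregular (R : realType) (U V : innerType R)
    (G : euc U -> set (euc V)) (u : euc U) (v : euc V) :=
  G u v /\ exists delta eps kappa : R,
    [/\ 0 < delta, 0 < eps, 0 < kappa &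
        forall x, closed_ball u eps x ->
          (dist x [set z | G z v] <=
             kappa%:E * dist v (G x `&` closed_ball v delta))%E].

Module EigenvalueVector.
Import complex.

Lemma char_poly_split (R : realType) n (A : 'M[R]_n) : A^T = A ->
  exists l : 'I_n -> R, char_poly A = \prod_i ('X - (l i)%:P).
Proof.
move=> Asym; pose f := real_complex R; pose B := map_mx f A.
have fsym : B \is hermsymmx.
  apply/is_hermitianmxP; rewrite expr0 scale1r; apply/matrixP => i j.
  by rewrite !mxE -[in LHS]Asym mxE; apply/esym/CrealP/complex_realP; exists (A j i).
have /orthomx_spectralP := hermitian_normalmx fsym.
have Punit := spectral_unit B.
have dreal := hermitian_spectral_diag_real fsym.
set p := spectralmx B in Punit *; set d := spectral_diag B in dreal *.
move=> BE.
exists (fun i => complex.Re (d 0 i)).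
apply: (@map_poly_inj _ _ f); rewrite map_char_poly -/B rmorph_prod.
have -> : char_poly B = char_poly (diag_mx d).
  rewrite /char_poly.
  have -> : char_poly_mx B = map_mx polyC (invmx p) *m char_poly_mx (diag_mx d) *m map_mx polyC p.
    rewrite /char_poly_mx mulmxBr mulmxBl -!map_mxM -BE scalar_mxC -mulmxA -map_mxM mulVmx//.
    by rewrite map_mx1 mulmx1.
  by rewrite !det_mulmx mulrAC -det_mulmx -map_mxM mulVmx// map_mx1 det1 mul1r.
rewrite char_poly_trig ?diag_mx_is_trig//; apply: eq_bigr => i _.
rewrite rmorphB/= map_polyX map_polyC/= mxE eqxx mulr1n; congr (_ - _%:P).
have /mxOverP/(_ 0 i) := dreal.
by move/RRe_real.
Qed.
End EigenvalueVector.

Section spectral.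
Variable R : realType.

Definition is_eigenvalue_vector n (A : 'M[R]_n) (l : 'E[R]_n) :=
  char_poly A = \prod_i ('X - (l i 0)%:P) /\
  forall i j : 'I_n, (i <= j)%N -> l j 0 <= l i 0.

Definition eigenvalues n (A : 'M[R]_n) : 'E[R]_n :=
  xget 0 [set l | is_eigenvalue_vector A l].

Lemma eigenvaluesP n (A : 'M[R]_n) : A^T = A ->
  is_eigenvalue_vector A (eigenvalues A).
Proof.
move=> /EigenvalueVector.char_poly_split[l lE].
suff ex : exists v : 'E[R]_n, is_eigenvalue_vector A v by exact: (xgetPex 0 ex).
pose t := sort >=%R (codom l).
have st : size t = n by rewrite size_sort size_codom card_ord.
exists (\col_i t`_i); split.
  rewrite lE -(big_image _ _ l predT (fun x => 'X - x%:P)).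
  have tl : perm_eq t (codom l) by rewrite perm_sort.
  rewrite -(perm_big _ tl) (big_nth 0) big_mkord st.
  by apply: eq_bigr => i _; rewrite mxE.
move=> i j ij; rewrite !mxE.
apply: (sorted_leq_nth (leT := fun x y => y <= x) _ _ 0) => //.
- by move=> x y z yx xz; apply: le_trans xz yx.
- by apply: sort_sorted => x y; apply: le_total.
- by rewrite inE st.
- by rewrite inE st.
Qed.

(* Square roots of the eigenvalues of the n x n matrix A A^T; used only when
   n <= m. *)
Definition singular_values n m (A : 'M[R]_(n, m)) : 'E[R]_n :=
  map_mx Num.sqrt (eigenvalues (A *m A^T)).

Definition perm_invariant n (g : 'E[R]_n -> \bar R) :=
  forall (Q : 'M[R]_n) (x : 'cV[R]_n), is_perm_mx Q -> g (Q *m x) = g x.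

Definition is_signed_perm_mx n (Q : 'M[R]_n) :=
  exists (P : 'M[R]_n) (e : 'I_n -> bool),
    is_perm_mx P /\ Q = diag_mx (\row_i (-1) ^+ e i) *m P.

Definition signed_perm_invariant n (g : 'E[R]_n -> \bar R) :=
  forall (Q : 'M[R]_n) (x : 'cV[R]_n), is_signed_perm_mx Q -> g (Q *m x) = g x.

Definition symmx_space n : {vspace 'M[R]_n} := fixedSpace (linfun (@trmx R n n)).

Lemma symmx_spaceP n (A : 'M[R]_n) : (A \in symmx_space n) = (A^T == A).
Proof. by apply/fixedSpaceP/eqP; rewrite lfunE. Qed.

(* R^{n x m} with singular values, or S^n with singular values or
   eigenvalues. *)
Variant spectral_setting :=
| RectSing n m of (n <= m)%N
| SymSing of nat
| SymEig of nat.

Definition spec_dim s :=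
  match s with RectSing n _ _ => n | SymSing n => n | SymEig n => n end.

Definition matrix_space s : innerType R :=
  match s with
  | RectSing n m _ => 'M[R]_(n, m)
  | SymSing n => subvs_of (symmx_space n)
  | SymEig n => subvs_of (symmx_space n)
  end.

Definition spectrum s : euc (matrix_space s) -> 'E[R]_(spec_dim s) :=
  match s with
  | RectSing n m _ => fun X => singular_values (X : 'M[R]_(n, m))
  | SymSing n => fun X => singular_values (vsval X)
  | SymEig n => fun X => eigenvalues (vsval X)
  end.

Definition spectral_symmetry s : ('E[R]_(spec_dim s) -> \bar R) -> Prop :=
  match s with
  | RectSing n _ _ => @signed_perm_invariant n
  | SymSing n => @signed_perm_invariant n
  | SymEig n => @perm_invariant n
  end.
End spectral.

Record problem (R : realType) (X : innerType R) (d e : nat) := Problem {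
  pC : euc X;
  pb : 'E[R]_e;
  pF : {linear euc X -> 'E[R]_d};
  pFadj : 'E[R]_d -> euc X;
  pF_adjoint : is_adjoint pF pFadj;
  pA : {linear euc X -> 'E[R]_e};
  pAadj : 'E[R]_e -> euc X;
  pA_adjoint : is_adjoint pA pAadj;
  ph : 'E[R]_d -> \bar R;
  ptheta : euc X -> \bar R;
  pQ : set 'E[R]_e }.

Section primal_dual.
Variables (R : realType) (X : innerType R) (d e : nat) (P : problem X d e).

Local Notation C := (pC P).
Local Notation b := (pb P).
Local Notation F := (pF P).
Local Notation F' := (pFadj P).
Local Notation A := (pA P).
Local Notation A' := (pAadj P).
Local Notation h := (ph P).
Local Notation theta := (ptheta P).
Local Notation Q := (pQ P).

Definition primal_objective (x : euc X) : \bar R :=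
  (h (F x) + (dot C x)%:E + theta x)%E.

Definition primal_feasible : set (euc X) := [set x | Q (A x - b)].

Definition primal_solutions := argmin primal_objective primal_feasible.

Definition dual_space : innerType R := ('cV[R]_e * 'cV[R]_d * X)%type.

Definition ycomp (Z : euc dual_space) : 'E[R]_e := Z.1.1.
Definition wcomp (Z : euc dual_space) : 'E[R]_d := Z.1.2.
Definition Scomp (Z : euc dual_space) : euc X := Z.2.

Definition dual_objective (Z : euc dual_space) : \bar R :=
  (indicator (dual_cone Q) (ycomp Z) - (dot b (ycomp Z))%:E
   + conjugate h (- wcomp Z)%R + conjugate theta (- Scomp Z)%R)%E.

Definition dual_affine : set (euc dual_space) :=
  [set Z | A' (ycomp Z) + F' (wcomp Z) + Scomp Z = C].

Definition dual_solutions := argmin dual_objective dual_affine.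

Definition dual_feasible : set (euc dual_space) :=
  [set Z | dual_affine Z /\ dual_cone Q (ycomp Z)].

(* The inclusions 0 \in A x - b + N(y), 0 \in F x - dh^*(-w) and
   0 \in x - dtheta^*(-S) are written as memberships in N(y), dh^*(-w) and
   dtheta^*(-S); likewise in [G1] and [G3]. *)
Definition dual_multipliers (Z : euc dual_space) : set (euc X) :=
  [set x | [/\ normal_cone (dual_cone Q) (ycomp Z) (b - A x),
               subdifferential (conjugate h) (- wcomp Z) (F x),
               subdifferential (conjugate theta) (- Scomp Z) x &
               C = A' (ycomp Z) + F' (wcomp Z) + Scomp Z]].

Definition G1 (x : euc X) : set (euc dual_space) :=
  [set Z | normal_cone (dual_cone Q) (ycomp Z) (b - A x)].

Definition G2 (wbar : 'E[R]_d) : set (euc dual_space) :=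
  [set Z | wcomp Z = wbar].

Definition G3 (x : euc X) : set (euc dual_space) :=
  [set Z | subdifferential theta x (- Scomp Z)].

End primal_dual.

(* Main.v *)
Require Import Defs.
From HB Require Import structures.
From mathcomp Require Import all_boot all_order all_algebra fingroup perm.
From mathcomp Require Import all_classical all_reals all_analysis.
From mathcomp Require Import ring lra.
Import Order.TTheory GRing.Theory Num.Theory.
Import numFieldNormedType.Exports.
Import Defs.

Set Implicit Arguments.
Unset Strict Implicit.
Unset Printing Implicit Defensive.

Local Open Scope classical_set_scope.
Local Open Scope ring_scope.

(** Let [x] be a multiplier at [Zbar] for which the collection is boundedly linearly
    regular. Since the linear terms pair to zero on the affine constraint, the
    excess of the dual objective at a feasible [Z = (y, w, S)] over its value at
    [Zbar] splits into three nonnegative parts ([dual_gap_split]): the excesses of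
    the polyhedral term, of the conjugate of [h] and of the conjugate of [theta]
    over their linearizations defined by [x]. Near [Zbar] each part dominates the
    squared distance from [Z] to one of the sets [G1], [G2], [G3]. Bounded linear
    regularity then bounds the squared distance to their intersection with the
    affine constraint, and the points of this intersection are solutions
    ([multiplier_solution]).

    For the polyhedral part, the dual cone is finitely generated by Farkas' lemma
    and it suffices to drop the generators on which the linear form is not zero
    ([polyhedral_normal_cone_growth]). For the conjugate of [h], strong convexity on
    a compact ball is enough ([strongly_convex_growth]).

    The conjugate of [theta] is the spectral function of the conjugate of [g]. For
    the latter, metric subregularity of the subdifferential gives quadratic
    growth by a proximal step ([growth_of_metric_subregularity]). The growth
    passes to matrices ([spectral_growth]) as follows. A matrix [Y] has an excess at
    least as large as the gap in the trace inequality for [x] and [Y], and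
    this gap controls how far [Y] is from being diagonal in a suitable frame that
    diagonalizes [x] ([adapted_frame]). Replacing [Y] by its diagonal does not
    increase the excess, which is thereby reduced to that of the vector on the
    diagonal.

    The matrix facts needed, namely diagonalization, the trace inequality and the
    stability of its equality case, all come from one variational principle: in
    the orbit of [Y] under orthogonal matrices, the functional [dot c] of the
    diagonal is maximized at a point where plane rotations give no gain, and for
    [c] strictly decreasing this forces the off-diagonal entries to vanish and the
    diagonal to be ordered. Applied to all frames it gives the first two
    facts ([spectral_maximum]); applied to the frames diagonalizing [x] it gives the
    third. Symmetric and rectangular matrices differ only in the rotations
    that are allowed. *)

(** * Elementary estimates *)

Lemma le0_of_le_small (R : realType) (a b : R) :
  (forall t, 0 < t < 1 -> a <= t * b) -> a <= 0.
Proof.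
move=> ab; rewrite leNgt; apply/negP => a0.
have b0 : 0 < b.
  have := ab 2^-1 _; rewrite invr_gt0 ltr0n invf_lt1 ?ltr1n// => /(_ isT) h.
  by have := lt_le_trans a0 h; rewrite pmulr_rgt0// invr_gt0.
have t0 : 0 < a / (2 * (a + b)) by rewrite divr_gt0 ?mulr_gt0 ?addr_gt0.
have t1 : a / (2 * (a + b)) < 1.
  by rewrite ltr_pdivrMr ?mul1r ?mulr_gt0 ?addr_gt0//; lra.
have := ab _ (introT andP (conj t0 t1)).
rewrite mulrAC ler_pdivlMr ?mulr_gt0 ?addr_gt0//; nra.
Qed.

Lemma sqrD_le (R : realDomainType) (a b : R) :
  (a + b) ^+ 2 <= 2 * (a ^+ 2 + b ^+ 2).
Proof. by have := sqr_ge0 (a - b); nra. Qed.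

Lemma finite_positive_bound (R : realType) (I : finType) (P : I -> R -> Prop) :
    (forall i, exists2 c, 0 < c & forall c', 0 < c' -> c' <= c -> P i c') ->
  exists2 c, 0 < c & forall i, P i c.
Proof.
move=> H; have /choice[c Hc] : forall i, exists c, 0 < c /\
    forall c', 0 < c' -> c' <= c -> P i c'.
  by move=> i; have [c] := H i; exists c.
pose m := \big[Num.min/1]_i c i.
have m0 : 0 < m by apply: lt_bigmin => // i _; have [] := Hc i.
exists m => // i; have [_] := Hc i; apply=> //; exact: bigmin_le_cond.
Qed.

Lemma finite_upper_bound (R : realType) (I : finType) (P : I -> R -> Prop) :
    (forall i, exists2 c, 0 <= c & forall c', c <= c' -> P i c') ->
  exists2 c, 0 <= c & forall i, P i c.
Proof.
move=> H; have /choice[c Hc] : forall i, exists c, 0 <= c /\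
    forall c', c <= c' -> P i c'.
  by move=> i; have [c] := H i; exists c.
exists (\sum_i c i); first by apply: sumr_ge0 => i _; have [] := Hc i.
move=> i; have [_] := Hc i; apply; rewrite (bigD1 i)//= lerDl.
by apply: sumr_ge0 => j _; have [] := Hc j.
Qed.

Lemma sqr_sum_bound (R : realType) (a b p q E : R) : p ^+ 2 <= E -> q ^+ 2 <= E ->
  (a * p + b * q) ^+ 2 <= 2 * (a ^+ 2 + b ^+ 2) * E.
Proof.
move=> pE qE; apply: le_trans (sqrD_le _ _) _; rewrite -mulrA ler_pM2l// mulrDl.
by rewrite !exprMn lerD// ler_wpM2l// sqr_ge0.
Qed.

(** * Inner product spaces *)

Section inner_product.
Variables (R : realType) (V : innerType R).
Implicit Types (x y z : euc V) (a : R).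

Lemma dotDr x y z : dot x (y + z) = dot x y + dot x z.
Proof. by rewrite dotC dotDl !(dotC _ x). Qed.

Lemma dotZr a x y : dot x (a *: y) = a * dot x y.
Proof. by rewrite dotC dotZl dotC. Qed.

Lemma dotNl x y : dot (- x) y = - dot x y.
Proof. by rewrite -scaleN1r dotZl mulN1r. Qed.

Lemma dotNr x y : dot x (- y) = - dot x y.
Proof. by rewrite dotC dotNl dotC. Qed.

Lemma dotBl x y z : dot (x - y) z = dot x z - dot y z.
Proof. by rewrite dotDl dotNl. Qed.

Lemma dotBr x y z : dot x (y - z) = dot x y - dot x z.
Proof. by rewrite dotDr dotNr. Qed.

Lemma dot0l x : dot 0 x = 0.
Proof. by rewrite -(scale0r (0 : euc V)) dotZl mul0r. Qed.

Lemma dot0r x : dot x 0 = 0.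
Proof. by rewrite dotC dot0l. Qed.

Lemma eucnormE x : `|x| = Num.sqrt (dot x x).
Proof. by []. Qed.

Lemma sqr_norm_dot x : `|x| ^+ 2 = dot x x.
Proof. by rewrite eucnormE sqr_sqrtr ?dot_ge0. Qed.

Lemma norm_dot_le x y : `|dot x y| <= `|x| * `|y|.
Proof.
rewrite -ler_sqr ?nnegrE ?mulr_ge0//.
by rewrite exprMn !sqr_norm_dot real_normK ?num_real// cauchy_schwarz.
Qed.

Lemma dot_le_norm x y : dot x y <= `|x| * `|y|.
Proof. exact: le_trans (ler_norm _) (norm_dot_le x y). Qed.

Lemma sqr_normB x y : `|x - y| ^+ 2 = `|x| ^+ 2 + `|y| ^+ 2 - 2 * dot x y.
Proof. by rewrite !sqr_norm_dot dotBl !dotBr (dotC y x); ring. Qed.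

Lemma dot_suml I (r : seq I) (P : pred I) (F : I -> euc V) y :
  dot (\sum_(i <- r | P i) F i) y = \sum_(i <- r | P i) dot (F i) y.
Proof.
elim/big_rec2 : _ => [|i a b _ <-]; first by rewrite dot0l.
by rewrite dotDl.
Qed.

End inner_product.

Lemma lipschitz_bound_continuous (R : realType) (V W : normedModType R)
    (f : V -> W) (k : R) :
  (forall x y, `|f x - f y| <= k * `|x - y|) -> continuous f.
Proof.
move=> fk x; apply/cvgrPdist_lt => e e0.
have k1 : 0 < `|k| + 1 by rewrite ltr_wpDl.
apply/nbhs_normP; exists (e / (`|k| + 1)); first by rewrite /= divr_gt0.
move=> y /=; rewrite ltr_pdivlMr// mulrC => /(le_lt_trans _); apply.
apply: le_trans (fk _ _) _; rewrite ler_wpM2r//.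
by rewrite (le_trans (ler_norm _))// lerDl.
Qed.

Section continuity.
Variables (R : realType) (V : innerType R).

Lemma dot_continuous (x : euc V) : continuous (dot x : euc V -> R).
Proof.
apply: (@lipschitz_bound_continuous _ (euc V) R^o _ `|x|) => y z.
by rewrite -dotBr norm_dot_le.
Qed.

Lemma dist_pt_continuous (x : euc V) : continuous (fun y : euc V => `|y - x|).
Proof.
apply: (@lipschitz_bound_continuous _ (euc V) R^o _ 1) => y z.
rewrite mul1r (le_trans (ler_dist_dist _ _))//.
by rewrite opprB addrA subrK.
Qed.

Lemma closed_ball_eucE (x : euc V) (r : R) : 0 < r ->
  closed_ball x r = [set y | `|x - y| <= r].
Proof. by move=> r0; rewrite closed_ballE. Qed.

End continuity.

(** * Compactness and existence of minimizers *)

Section matrix_space_compactness.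
Variables (R : realType) (m n : nat).
Implicit Types A B : euc 'M[R]_(m, n).

Lemma mx_dotE A B : dot A B = \sum_i \sum_j A i j * B i j.
Proof.
rewrite exchange_big /=.
by apply: eq_bigr => j _; rewrite mxE; apply: eq_bigr => i _; rewrite mxE.
Qed.

Lemma entry_le_norm A i j : `|A i j| <= `|A|.
Proof.
rewrite -ler_sqr ?nnegrE// real_normK ?num_real// sqr_norm_dot mx_dotE.
rewrite (bigD1 i)//= (bigD1 j)//= -expr2 -addrA lerDl.
by rewrite addr_ge0// ?sumr_ge0// => k _; rewrite ?sumr_ge0// => *;
  rewrite -expr2 sqr_ge0.
Qed.

Lemma entry_continuous i j : continuous (fun A => A i j).
Proof.
apply: (@lipschitz_bound_continuous _ (euc 'M[R]_(m, n)) R^o _ 1) => A B.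
by rewrite mul1r (le_trans _ (entry_le_norm _ i j))// !mxE.
Qed.

Lemma norm_vec_mx_le (x : 'rV[R]_(m * n)) :
  `|vec_mx x : euc 'M[R]_(m, n)| <= Num.sqrt (m * n)%:R * `|x|.
Proof.
rewrite eucnormE mx_dotE -[X in _ * X]ger0_norm// -sqrtr_sqr -sqrtrM//.
apply: ler_wsqrtr.
apply: (@le_trans _ _ (\sum_(i < m) \sum_(j < n) `|x| ^+ 2)).
  apply: ler_sum => i _; apply: ler_sum => j _.
  rewrite mxE -expr2 -real_normK ?num_real// ler_sqr ?nnegrE//.
  by rewrite /Num.norm /= mx_normrE; apply/bigmax_geP; right;
    exists (ord0, mxvec_index i j).
by rewrite !sumr_const !card_ord -mulrnA [leRHS]mulr_natl [(n * m)%N]mulnC.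
Qed.

(** Compactness of closed bounded sets of row vectors with the sup norm carries over
    along reshaping, which is Lipschitz into the Euclidean norm. *)
Lemma closed_bounded_mx_compact (S : set (euc 'M[R]_(m, n))) (r : R) :
  closed S -> (forall A, S A -> `|A| <= r) -> compact S.
Proof.
move=> clS Sr; pose f (x : 'rV[R]_(m * n)) : euc 'M[R]_(m, n) := vec_mx x.
have fc : continuous f.
  apply: (@lipschitz_bound_continuous _ _ (euc 'M[R]_(m, n)) _
    (Num.sqrt (m * n)%:R)) => x y.
  by rewrite /f -linearB norm_vec_mx_le.
have -> : S = f @` (f @^-1` S).
  rewrite image_preimage//; apply/seteqP; split => // A _.
  by exists (mxvec A) => //; rewrite /f mxvecK.
apply: continuous_compact; first exact: continuous_subspaceT.
apply: bounded_closed_compact; last exact: (proj1 (continuous_closedP f)).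
exists r; split; first exact: num_real.
move=> M rM x /Sr fxr; rewrite /Num.norm /= mx_normrE.
apply/bigmax_leP; split=> [|[i j] _ /=].
  exact: le_trans (le_trans (normr_ge0 _) fxr) (ltW rM).
apply: le_trans (ltW rM); apply: le_trans fxr.
rewrite (ord1 i).
case: (mxvec_indexP j) => a b.
by have := entry_le_norm (f x) a b; rewrite mxE.
Qed.

End matrix_space_compactness.

Lemma closed_ball_mx_compact (R : realType) m n (x : euc 'M[R]_(m, n)) (r : R) :
  0 < r -> compact (closed_ball x r).
Proof.
move=> r0; apply: (@closed_bounded_mx_compact _ _ _ _ (r + `|x|)).
  exact: closed_ball_closed.
rewrite closed_ball_eucE// => y /= xy; rewrite -[y](subrK x).
by rewrite (le_trans (ler_normD _ _))// lerD2r distrC.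
Qed.

Section minimization.
Variables (R : realType) (T : ptopologicalType).
Local Open Scope ereal_scope.

(** The sublevel sets at the values of [f] have the finite intersection property,
    because finitely many points of [K] include one of least value; by
    compactness they share a point. *)
Lemma compact_closed_sublevel_min (K : set T) (f : T -> \bar R) :
    compact K -> K !=set0 ->
    (forall x, K x -> closed [set y | f y <= f x]) ->
  exists2 p, K p & forall x, K x -> f p <= f x.
Proof.
move=> cK K0 clf.
pose I : choiceType := {classic T}; pose K' : set I := K.
pose F (x : I) := K `&` [set y | f y <= f x].
have := cK; rewrite compact_In0 => /(_ I K' F).
have fc : closed_fam_of K K' F by exists (fun x => [set y | f y <= f x]).
move=> /(_ fc) H.
have : finI K' F.
  move=> D DK; have [x Kx] := K0.
  have sK (y : I) : y \in finmap.enum_fset D -> K y.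
    by move=> ys; exact: (set_mem (DK y ys)).
  suff [p Kp fp] : exists2 p, K p &
      forall y : I, y \in finmap.enum_fset D -> f p <= f y.
    by exists p => y Dy; split => //; exact: fp.
  elim: (finmap.enum_fset D) sK => [_|y s IH sK]; first by exists x.
  have Ky : K y by apply: sK; rewrite mem_head.
  have [z zs|p Kp fp] := IH; first by apply: sK; rewrite in_cons zs orbT.
  have [fpy|/ltW fyp] := leP (f p) (f y).
    by exists p => // z; rewrite in_cons => /orP[/eqP->//|/fp].
  exists y => // z; rewrite in_cons => /orP[/eqP->//|/fp].
  exact: le_trans.
move=> /H[p Hp]; have [x Kx] := K0; exists p; first by have [] := Hp _ Kx.
by move=> y /Hp[].
Qed.

End minimization.

(** * Conjugate functions and subdifferentials *)

Section conjugate_functions.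
Variables (R : realType) (V : innerType R).
Implicit Types (f : euc V -> \bar R) (x y z : euc V).

Lemma fenchel_young f x y : ((dot x y)%:E - f x <= conjugate f y)%E.
Proof. by apply: ereal_sup_ubound; exists x. Qed.

Lemma fenchel_young_fin f x y (a : R) :
  f x = a%:E -> ((dot x y - a)%:E <= conjugate f y)%E.
Proof. by move=> fx; have := fenchel_young f x y; rewrite fx -EFinB. Qed.

Lemma proper_fin f : proper f -> exists x (a : R), f x = a%:E.
Proof.
move=> [fNy [x fx]]; exists x, (fine (f x)).
by rewrite fineK// fin_numE fNy -ltey.
Qed.

Lemma conjugate_gtNy f y : proper f -> conjugate f y != -oo%E.
Proof.
move=> /proper_fin[x [a fx]]; rewrite -ltNye.
exact: lt_le_trans (ltNyr _) (fenchel_young_fin y fx).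
Qed.

Lemma conjugate_leP f y (b : R) : proper f ->
  (conjugate f y <= b%:E)%E <-> forall x a, f x = a%:E -> dot x y - a <= b.
Proof.
move=> [fNy _]; split=> [fyb x a fx|H].
  by rewrite -lee_fin; apply: le_trans (fenchel_young_fin y fx) fyb.
apply: ge_ereal_sup => _ [x _ <-].
have := fNy x; case fx : (f x) => [a| |]// _; last by rewrite leNye.
by rewrite -EFinB lee_fin H.
Qed.

Lemma subdifferential_conjugate f x y (a : R) :
    f x = a%:E -> (conjugate f y <= (dot x y - a)%:E)%E ->
  subdifferential (conjugate f) y x.
Proof.
move=> fx fyle z; apply: le_trans (fenchel_young_fin z fx).
by rewrite (le_trans (leeD2r _ fyle))// -EFinD lee_fin dotBr; lra.
Qed.

Lemma subdifferential_of_conjugate f x y (a : R) : proper f ->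
    f x = a%:E -> (conjugate f y <= (dot x y - a)%:E)%E ->
  subdifferential f x y.
Proof.
move=> pf fx /(conjugate_leP _ _ pf) fyle z.
have := (proj1 pf) z; case fz : (f z) => [c| |]// _; last by rewrite leey.
have := fyle _ _ fz; rewrite fx -EFinD lee_fin dotBr (dotC y) (dotC y); lra.
Qed.

Lemma subdifferential_fin f x y : proper f -> subdifferential f x y ->
  exists a : R, f x = a%:E.
Proof.
move=> pf; have := proper_fin pf => -[z [b fz]] /(_ z); rewrite fz.
have := (proj1 pf) x; case: (f x) => [a| |]// _; first by exists a.
Qed.

Lemma conjugate_of_subdifferential f x y (a : R) : proper f ->
    f x = a%:E -> subdifferential f x y ->
  conjugate f y = (dot x y - a)%:E.
Proof.
move=> pf fx sub; apply/eqP; rewrite eq_le fenchel_young_fin// andbT.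
apply/(conjugate_leP _ _ pf) => z c fz.
by have := sub z; rewrite fx fz -EFinD lee_fin dotBr (dotC y) (dotC y); lra.
Qed.

Lemma conjugate_convex_le f x y (a b t : R) : proper f -> 0 < t < 1 ->
    (conjugate f x <= a%:E)%E -> (conjugate f y <= b%:E)%E ->
  (conjugate f (t *: x + (1 - t) *: y)%R <= (t * a + (1 - t) * b)%:E)%E.
Proof.
move=> pf /andP[t0 t1] /(conjugate_leP _ _ pf) fx /(conjugate_leP _ _ pf) fy.
apply/(conjugate_leP _ _ pf) => z c fz; rewrite dotDr !dotZr.
have := fx _ _ fz; have := fy _ _ fz; nra.
Qed.

(** A conjugate is a supremum of affine functions, so its sublevel sets, also after
    adding a continuous [q], are intersections of closed sets. *)
Lemma conjugate_sublevel_closed f (q : euc V -> R) (a : \bar R) : proper f ->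
  continuous q -> a != -oo%E ->
  closed [set y | (conjugate f y + (q y)%:E <= a)%E].
Proof.
move=> pf cq; case: a => [a| |]// _; last first.
  have -> : [set y | (conjugate f y + (q y)%:E <= +oo)%E] = setT; last exact: closedT.
  by apply/seteqP; split => // y _ /=; rewrite leey.
have -> : [set y | (conjugate f y + (q y)%:E <= a%:E)%E] =
    \bigcap_(xc in [set xc : euc V * R | f xc.1 = xc.2%:E])
      [set y | dot xc.1 y + q y \in `]-oo, a + xc.2]].
  apply/seteqP; split => y /=.
    rewrite -leeBrDr// -EFinB => /(conjugate_leP _ _ pf) fy [x c]/= fx.
    by rewrite in_itv/=; have := fy _ _ fx; lra.
  move=> H; rewrite -leeBrDr// -EFinB; apply/(conjugate_leP _ _ pf) => x c fx.
  by have := H (x, c) fx; rewrite /= in_itv/=; lra.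
apply: closed_bigI => -[x c] /= _.
apply: (@closed_comp _ _ (fun y => dot x y + q y) [set` `]-oo, a + c]]).
  by move=> y _; apply: (@continuousD _ _ _ (dot x : euc V -> R) q y); [exact: dot_continuous|exact: cq].
exact: interval_closed.
Qed.

End conjugate_functions.

(** * Quadratic growth from metric subregularity *)

Section growth_from_subregularity.
Variables (R : realType) (n : nat) (g : 'E[R]_n -> \bar R).
Hypothesis g_proper : proper g.
Implicit Types u v y z p : 'E[R]_n.

(** The point [p] minimizes the sum of the excess of the conjugate over its tangent
    plane at [ybar] and of [u |-> 2^-1 * `|u - y| ^+ 2]. Comparing with [u = ybar]
    gives the distance bound, comparing with [u = y] the last one, and comparing
    along segments issued from [p] the subgradient. *)
Lemma conjugate_proximal_point v y ybar (c : R) :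
    conjugate g ybar = c%:E -> subdifferential (conjugate g) ybar v ->
  exists p, [/\ subdifferential (conjugate g) p (v + (y - p)),
    `|y - p| <= `|ybar - y| &
    forall r, (conjugate g y <= (c + dot v (y - ybar) + r)%:E)%E ->
      `|y - p| ^+ 2 <= 2 * r].
Proof.
move=> gybar subv.
pose q u : R := 2^-1 * `|u - y| ^+ 2 - dot v u.
pose F u : \bar R := (conjugate g u + (q u)%:E)%E.
have lowF u b : (conjugate g u <= b%:E)%E -> c + dot v (u - ybar) <= b.
  by move=> gu; have := le_trans (subv u) gu; rewrite gybar -EFinD lee_fin.
have qc : continuous q.
  move=> u; apply: (@continuousB _ R^o _ (fun u => 2^-1 * `|u - y| ^+ 2)
    (dot v : 'E[R]_n -> R)); last exact: dot_continuous.
  apply: (@continuousM _ _ (fun=> 2^-1) (fun u => `|u - y| ^+ 2)).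
    exact: cst_continuous.
  rewrite (_ : (fun u => `|u - y| ^+ 2) = (fun u => `|u - y| * `|u - y|)).
    apply: (@continuousM _ _ (fun u => `|u - y|) (fun u => `|u - y|));
      exact: dist_pt_continuous.
  by apply/funext => w; rewrite expr2.
pose K := [set u : 'E[R]_n | `|u - y| <= `|ybar - y|].
have Kc : compact K.
  apply: (@closed_bounded_mx_compact _ _ _ K (`|ybar - y| + `|y|)).
    rewrite (_ : K = (fun u => `|u - y|) @^-1` [set` `]-oo, `|ybar - y|]]).
      apply: preimage_closed; last exact: interval_closed.
      by move=> u _; exact: dist_pt_continuous.
    by apply/seteqP; split => u; rewrite /= in_itv.
  move=> u Ku; rewrite -[u](subrK y) (le_trans (ler_normD _ _))//.
  by rewrite lerD2r.
have Kybar : K ybar by exact: lexx.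
have [p Kp minK] : exists2 p, K p & forall u, K u -> (F p <= F u)%E.
  apply: compact_closed_sublevel_min => //; first by exists ybar.
  move=> u _; apply: conjugate_sublevel_closed => //.
  by have := conjugate_gtNy u g_proper; rewrite /F; case: (conjugate g u).
have Fp : (F p <= F ybar)%E by exact: minK.
(* outside [K] the quadratic term alone exceeds the value at [ybar] *)
have {minK} minF u : (F p <= F u)%E.
  have [/minK//|uK] := leP `|u - y| `|ybar - y|.
  apply: le_trans Fp _; rewrite /F gybar.
  have := conjugate_gtNy u g_proper.
  case gu : (conjugate g u) => [b| |]// _; last by rewrite leey.
  have := lowF u b; rewrite gu => /(_ (lexx _)).
  rewrite -!EFinD lee_fin /q dotBr.
  have : `|ybar - y| ^+ 2 < `|u - y| ^+ 2 by rewrite ltr_pXn2r ?nnegrE.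
  lra.
have [a gp] : exists a, conjugate g p = a%:E.
  move: Fp; rewrite /F gybar; have := conjugate_gtNy p g_proper.
  by case: (conjugate g p) => [a| |]// _ _; exists a.
exists p; split.
- move=> z; rewrite gp.
  have := conjugate_gtNy z g_proper.
  case gz : (conjugate g z) => [b| |]// _; last by rewrite leey.
  rewrite -EFinD lee_fin -subr_le0.
  apply: (@le0_of_le_small _ _ (2^-1 * `|z - p| ^+ 2)) => t t01.
  have gw : (conjugate g (t *: z + (1 - t) *: p)%R <= (t * b + (1 - t) * a)%:E)%E.
    by apply: conjugate_convex_le => //; rewrite ?gz ?gp.
  have := le_trans (minF (t *: z + (1 - t) *: p)) (leeD2r _ gw).
  rewrite /F gp -!EFinD lee_fin /q.
  have -> : t *: z + (1 - t) *: p - y = (p - y) + t *: (z - p).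
    by rewrite scalerBl scale1r scalerBr [RHS]addrC -!addrA; congr (_ + _);
       rewrite addrCA addrC -!addrA.
  rewrite !sqr_norm_dot !(dotDl, dotDr, dotZl, dotZr, dotBl, dotBr, dotNl, dotNr).
  rewrite (dotC z p) (dotC z y) (dotC p y).
  case/andP: t01 => t0 t1 H.
  rewrite -(ler_pM2l t0); nra.
- by rewrite distrC.
- move=> r gy; have := le_trans (minF y) (leeD2r _ gy).
  have := lowF p a; rewrite gp lexx => /(_ isT).
  rewrite /F gp -!EFinD lee_fin /q subrr normr0 expr0n /= mulr0 sub0r !dotBr.
  by rewrite (distrC p y); lra.
Qed.

(** The proximal step from [y] lands at a point [p] with [v + (y - p)] in the
    subdifferential at [p], so that subregularity bounds the distance of [p] to
    the solution set by a multiple of [|y - p|], while half the square of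
    [|y - p|] is at most the excess [r] of the function over its tangent
    plane. *)
Lemma growth_of_metric_subregularity v ybar (c : R) :
    conjugate g ybar = c%:E -> subdifferential (conjugate g) ybar v ->
    metrically_subregular (subdifferential (conjugate g)) ybar v ->
  exists2 eps : R, 0 < eps & forall y r, `|y - ybar| <= eps ->
    (conjugate g y <= (c + dot v (y - ybar) + r)%:E)%E ->
    exists2 z, subdifferential (conjugate g) z v & eps * `|y - z| ^+ 2 <= r.
Proof.
move=> gybar subv [_ [delta [eps [kappa [delta0 eps0 kappa0 subreg]]]]].
pose K := 2 * (1 + 2 * kappa) ^+ 2.
have K0 : 0 < K by rewrite mulr_gt0// exprn_gt0// addr_gt0// mulr_gt0.
pose e := Num.min (Num.min (eps / 2) delta) K^-1.
have e0 : 0 < e by rewrite !lt_min invr_gt0 K0 divr_gt0// delta0.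
exists e => // y r yybar gy.
have [p [subp pybar pr]] := conjugate_proximal_point y gybar subv.
have {}pr := pr _ gy.
have eE : [/\ e <= eps / 2, e <= delta & e <= K^-1].
  by split; rewrite /e !ge_min lexx ?orbT.
case: eE => e1 e2 e3.
rewrite [X in _ <= X]distrC in pybar.
have yp : `|y - p| <= e by exact: le_trans pybar yybar.
have peps : closed_ball ybar eps p.
  rewrite closed_ball_eucE// /= distrC -[p](subrK y) -addrA.
  by rewrite (le_trans (ler_normD _ _))// distrC; lra.
(* the factor 2 leaves room for approximating the infimum that defines the
   distance; there is no room when [y = p], but then [p] belongs to the set *)
have [z subz pz] : exists2 z, subdifferential (conjugate g) z v &
    `|p - z| <= 2 * kappa * `|y - p|.
  have [yp0|yp0] := eqVneq y p.
    exists p; last by rewrite yp0 !subrr normr0 mulr0.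
    by move: subp; rewrite yp0 subrr addr0.
  have yp1 : 0 < `|y - p| by rewrite normr_gt0 subr_eq0.
  have : (dist p [set z | subdifferential (conjugate g) z v] <
      (2 * kappa * `|y - p|)%:E)%E.
    apply: (@le_lt_trans _ _ (kappa%:E * `|y - p|%:E)%E).
      apply: le_trans (subreg p peps) _.
      rewrite lee_pmul2l//; apply: ereal_inf_lbound.
      exists (v + (y - p)).
        split => //; rewrite closed_ball_eucE//= opprD addrA subrr sub0r normrN.
        exact: le_trans yp e2.
      by rewrite opprD addrA subrr sub0r normrN.
    by rewrite -EFinM lte_fin ltr_pM2r// ltr_pMl// ltr1n.
  by move=> /ereal_inf_lt[_ [z subz <-]]; rewrite lte_fin => /ltW pz; exists z.
exists z => //.
have yz : `|y - z| <= (1 + 2 * kappa) * `|y - p|.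
  rewrite -[y - z](subrKA p) (le_trans (ler_normD _ _))//.
  by rewrite mulrDl mul1r lerD2l.
have yz2 : `|y - z| ^+ 2 <= K * r.
  apply: (@le_trans _ _ ((1 + 2 * kappa) ^+ 2 * `|y - p| ^+ 2)).
    by rewrite -exprMn lerXn2r ?nnegrE// mulr_ge0// addr_ge0// mulr_ge0// ltW.
  by rewrite (_ : K * r = (1 + 2 * kappa) ^+ 2 * (2 * r)) ?ler_wpM2l ?sqr_ge0// /K; ring.
apply: (@le_trans _ _ (K^-1 * (K * r))); last by rewrite mulKf ?gt_eqF.
by apply: ler_pM => //; exact: ltW.
Qed.

End growth_from_subregularity.

(** * Growth of the polyhedral and strongly convex terms *)

Section polyhedral_growth.
Variables (R : realType) (V : innerType R).
Implicit Types (a : nat -> euc V) (b q y z : euc V).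

(** Farkas' lemma, by induction on the number of inequalities: a point [w]
    satisfying the first [k] of them and violating the conclusion makes
    [a k] positive, and projecting all the functionals along [w] onto those
    vanishing at [w] removes [a k]. *)
Lemma farkas k a b :
    (forall z, (forall i, (i < k)%N -> dot (a i) z <= 0) -> dot b z <= 0) ->
  exists mu : nat -> R, (forall i, 0 <= mu i) /\ b = \sum_(i < k) mu i *: a i.
Proof.
elim: k a b => [|k IH] a b H.
  exists (fun=> 0); split=> //; rewrite big_ord0; apply: dot_eq0.
  by apply/le_anti; rewrite dot_ge0 andbT H.
have [Hk|] := pselect (forall z,
    (forall i, (i < k)%N -> dot (a i) z <= 0) -> dot b z <= 0).
  have [mu [mu0 ->]] := IH _ _ Hk.
  exists (fun i => if (i < k)%N then mu i else 0); split=> [i|].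
    by case: ifP.
  rewrite big_ord_recr /= ltnn scale0r addr0.
  by apply: eq_bigr => i _; rewrite ltn_ord.
move=> /existsNP[w /not_implyP[aw /negP]]; rewrite -ltNge => bw.
have akw : 0 < dot (a k) w.
  rewrite ltNge; apply/negP => akw.
  have := H w; rewrite leNgt bw => /(_ _)/negP; apply=> // i.
  by rewrite ltnS leq_eqVlt => /orP[/eqP->//|/aw].
pose c i := dot (a i) w / dot (a k) w.
pose cb := dot b w / dot (a k) w.
have [z Hz|mu [mu0 bE]] := IH (fun i => a i - c i *: a k) (b - cb *: a k).
  pose z' := z - (dot (a k) z / dot (a k) w) *: w.
  have E u : dot u z' = dot (u - (dot u w / dot (a k) w) *: a k) z.
    by rewrite dotBr dotZr dotBl dotZl; ring.
  rewrite -E; apply: H => i; rewrite ltnS leq_eqVlt => /orP[/eqP->|ik].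
    by rewrite dotBr dotZr divfK ?gt_eqF// subrr.
  by rewrite E; exact: Hz.
exists (fun i => if (i < k)%N then mu i else
  cb - \sum_(j < k) mu j * c j); split=> [i|].
  case: ifP => // _; rewrite subr_ge0; apply: (@le_trans _ _ 0).
    apply: sumr_le0 => j _; rewrite mulr_ge0_le0//.
    by rewrite pmulr_lle0 ?invr_gt0// aw.
  by rewrite divr_ge0// ltW.
rewrite big_ord_recr /= ltnn scalerBl scaler_suml.
under eq_bigr do rewrite ltn_ord.
rewrite addrCA -sumrB -[LHS](subrK (cb *: a k)) bE addrC; congr (_ + _).
by apply: eq_bigr => i _; rewrite scalerBr scalerA.
Qed.

(** By Farkas' lemma the dual of a cone given by inequalities is finitely
    generated. *)
Lemma dual_polyhedral_cone_generators (D : set (euc V)) : polyhedral_cone D ->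
  exists k a, (forall i, (i < k)%N -> dual_cone D (- a i)) /\
    forall y, dual_cone D y -> exists mu : nat -> R,
      (forall i, 0 <= mu i) /\ y = - \sum_(i < k) mu i *: a i.
Proof.
move=> [k [a DE]]; pose a' i := oapp a 0 (insub i).
have a'E (i : 'I_k) : a' i = a i by rewrite /a' valK.
exists k, a'; split.
  move=> i ik z; rewrite DE => /(_ (Ordinal ik)).
  by rewrite dotNl oppr_ge0 (a'E (Ordinal ik)).
move=> y yD; have [|mu [mu0 yE]] := @farkas k a' (- y).
  move=> z Hz; rewrite dotNl oppr_le0; apply: yD; rewrite DE => i.
  by rewrite -a'E; exact: Hz.
by exists mu; split => //; rewrite -yE opprK.
Qed.

(** Over the cone generated by vectors [- a i] the linear form [- q] has
    nonnegative values on the generators, and its zero set is the face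
    generated by those where it vanishes. Dropping the other generators from
    [y] costs at most a constant times [- dot q y], because they are finitely
    many. *)
Lemma polyhedral_normal_cone_growth (D : set (euc V)) q ybar :
    polyhedral_cone D -> normal_cone (dual_cone D) ybar q ->
  exists2 eps : R, 0 < eps & forall y r, dual_cone D y ->
    `|y - ybar| <= eps -> - dot q (y - ybar) <= r ->
    exists2 z, normal_cone (dual_cone D) z q & eps * `|y - z| ^+ 2 <= r.
Proof.
move=> /dual_polyhedral_cone_generators[k [a [aD genD]]] [ybarD qN].
have cone0 : dual_cone D 0 by move=> z _; rewrite dot0l.
have qybar : dot q ybar = 0.
  apply/le_anti/andP; split.
    have := qN (ybar + ybar); rewrite addrK; apply=> z Dz.
    by rewrite dotDl addr_ge0// ybarD.
  by have := qN 0 cone0; rewrite sub0r dotNr oppr_le0.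
have qle z : dual_cone D z -> dot q z <= 0.
  by move=> /qN; rewrite dotBr qybar subr0.
have qa i : (i < k)%N -> 0 <= dot q (a i).
  by move=> ik; rewrite -oppr_le0 -dotNr qle//; exact: aD.
pose M := 1 + \sum_(i < k) `|a i| / dot q (a i).
have Mpart (i : 'I_k) : `|a i| / dot q (a i) <= M.
  rewrite /M (bigD1 i)//= addrCA lerDl addr_ge0// sumr_ge0// => j _.
  by rewrite divr_ge0// qa.
have M0 : 0 < M.
  by rewrite /M ltr_pwDl// sumr_ge0// => j _; rewrite divr_ge0// qa.
pose N := M ^+ 2 * (`|q| + 1).
have N0 : 0 < N by rewrite mulr_gt0 ?exprn_gt0// ltr_wpDl.
exists (Num.min 1 N^-1); first by rewrite lt_min ltr01 invr_gt0.
move=> y r yD; rewrite le_min => /andP[yybar1 _].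
rewrite dotBr qybar subr0 => qyr.
have [mu [mu0 yE]] := genD y yD.
pose z := - \sum_(i < k | dot q (a i) == 0) mu i *: a i.
have yz : y - z = - \sum_(i < k | dot q (a i) != 0) mu i *: a i.
  rewrite yE /z opprK (bigID (fun i : 'I_k => dot q (a i) == 0))/= opprD.
  by rewrite addrAC addNr add0r.
have qz : dot q z = 0.
  rewrite /z dotNr dotC dot_suml big1 ?oppr0// => i /eqP qi.
  by rewrite dotZl dotC qi mulr0.
have qy : - dot q y = \sum_(i < k | dot q (a i) != 0) mu i * dot q (a i).
  rewrite -[y](subrK z) dotDr qz addr0 yz dotNr opprK dotC dot_suml.
  by apply: eq_bigr => i _; rewrite dotZl dotC.
have qy0 : 0 <= - dot q y by rewrite oppr_ge0 qle.
exists z.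
  split=> [w Dw|w wD]; last by rewrite dotBr qz subr0 qle.
  rewrite /z dotNl dot_suml oppr_ge0 sumr_le0// => i _.
  rewrite dotZl mulr_ge0_le0// -oppr_ge0 -dotNl.
  exact: (aD _ (ltn_ord i)).
have yzM : `|y - z| <= M * - dot q y.
  rewrite yz normrN (le_trans (ler_norm_sum _ _ _))// qy mulr_sumr.
  apply: ler_sum => i qi; rewrite normrZ ger0_norm// mulrCA ler_wpM2l//.
  have qai : 0 < dot q (a i) by rewrite lt_def qi qa.
  by rewrite -ler_pdivrMr// Mpart.
have qyN : - dot q y <= `|q| + 1.
  rewrite (_ : dot q y = dot q (y - ybar)); last by rewrite dotBr qybar subr0.
  rewrite (le_trans (ler_norm _))// normrN (le_trans (norm_dot_le _ _))//.
  rewrite (@le_trans _ _ `|q|) ?lerDl//.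
  by rewrite -[leRHS]mulr1 ler_wpM2l.
have yz2 : `|y - z| ^+ 2 <= N * r.
  apply: (@le_trans _ _ ((M * - dot q y) ^+ 2)).
    by rewrite lerXn2r ?nnegrE// mulr_ge0// ltW.
  rewrite exprMn /N -mulrA ler_wpM2l ?sqr_ge0// expr2.
  by apply: ler_pM.
apply: (@le_trans _ _ (N^-1 * (N * r))); last by rewrite mulKf ?gt_eqF.
apply: ler_pM => //; last by rewrite ge_min lexx orbT.
by rewrite le_min ler01 invr_ge0 ltW.
Qed.

End polyhedral_growth.

Lemma closed_ball_euc_convex (R : realType) (V : innerType R) (x : euc V) (r : R) :
  0 < r -> convex_set (closed_ball x r).
Proof.
move=> r0; rewrite closed_ball_eucE//.
apply/convex_setW => y z; rewrite !inE /= => xy xz t t0 t1; rewrite !inE/=.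
have -> : x - (t%:num *: y + (1 - t%:num) *: z) =
    t%:num *: (x - y) + (1 - t%:num) *: (x - z).
  by rewrite !scalerBr addrACA -scalerDl subrKC scale1r opprD.
rewrite (le_trans (ler_normD _ _))// !normrZ.
have := ltW t0; have := ltW t1; rewrite -subr_ge0 => t1' t0'.
rewrite !ger0_norm//; nra.
Qed.

(** The inequality of strong convexity at the midpoint of [x] and [u], combined
    with the subgradient inequality there. *)
Lemma strongly_convex_growth (R : realType) d (f : 'E[R]_d -> \bar R)
    (u s : 'E[R]_d) (c : R) :
    open (edom f) -> strongly_convex_on_compacts f ->
    f u = c%:E -> subdifferential f u s ->
  exists2 eps : R, 0 < eps & forall x r, `|x - u| <= eps ->
    (f x <= (c + dot s (x - u) + r)%:E)%E -> eps * `|x - u| ^+ 2 <= r.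
Proof.
move=> opf scf fu sub.
have fdom : edom f u by rewrite /edom /= fu ltry.
have /nbhs_closedballP[r0 ballf] := open_nbhs_nbhs (conj opf fdom).
have r00 : 0 < r0%:num by [].
have [mu mu0 scmu] := scf _ (closed_ball_mx_compact (x := u) r00)
  (closed_ball_euc_convex (x := u) r00) ballf.
pose eps := Num.min r0%:num (mu / 4).
exists eps; first by rewrite lt_min divr_gt0// andbT.
move=> x r; rewrite le_min => /andP[xr _] fxr.
have xK : closed_ball u r0%:num x by rewrite closed_ball_eucE//= distrC.
have uK : closed_ball u r0%:num u by exact: closed_ballxx.
have xmid : 2^-1 *: x + (1 - 2^-1) *: u - u = 2^-1 *: (x - u).
  by rewrite scalerBl scale1r scalerBr -addrA addrAC subrr sub0r.
have half01 : 0 <= (2^-1 : R) <= 1 by rewrite invr_ge0 ler0n invf_le1 ?ler1n.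
have := scmu x u 2^-1 xK uK half01.
move=> /(le_trans (sub _)); rewrite fu xmid dotZr.
have le_half : (2^-1%:E * f x <= 2^-1%:E * (c + dot s (x - u) + r)%:E)%E.
  by rewrite lee_pmul2l ?lte_fin ?invr_gt0.
move=> /le_trans /(_ (leeD2r _ (leeD2r _ le_half))).
rewrite -?EFinM -?EFinN -?EFinD -?EFinB lee_fin => H.
have e4 : eps <= mu / 4 by rewrite ge_min lexx orbT.
apply: (@le_trans _ _ (mu / 4 * `|x - u| ^+ 2)).
  by rewrite ler_wpM2r ?sqr_ge0.
move: H; set N := `|x - u| ^+ 2; lra.
Qed.

(** * Growth of the conjugate of a spectral function *)

Section spectral_systems.
Variables (R : realType) (V : innerType R) (n : nat).
Variables (lam : euc V -> 'E[R]_n) (I : finType) (Q : I -> 'M[R]_n).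
Implicit Types (X Y : euc V) (x y : 'E[R]_n).
Implicit Types (Phi : 'E[R]_n -> euc V) (Psi : euc V -> 'E[R]_n).

(** The model is [Phi x = U^T *m diag x *m V] for fixed orthogonal [U] and [V]; the
    adjoint [Psi] reads the diagonal in these bases. The [Q i] are the permutation
    matrices, with signs in the case of singular values. *)
Record spectral_frame Phi Psi := SpectralFrame {
  frame_adj : forall x Y, dot (Phi x) Y = dot x (Psi Y);
  frame_iso : forall x y, dot (Phi x) (Phi y) = dot x y;
  frame_lam : forall x, exists i, lam (Phi x) = Q i *m x }.

(** The field [sys_frame] is a quantitative form of the equality case of the trace
    inequality: a small gap between [X] and [Y] makes [Y] nearly diagonal in some
    frame that diagonalizes [X]. *)
Record spectral_system := SpectralSystem {
  sys_orth : forall i, Q i *m (Q i)^T = 1%:M;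
  sys_trace : forall X Y, dot X Y <= dot (lam X) (lam Y);
  sys_frame : forall X L, exists C, forall Y, `|Y| <= L ->
    exists Phi Psi, [/\ spectral_frame Phi Psi, X = Phi (lam X) &
      `|Y - Phi (Psi Y)| ^+ 2 <= C * (dot (lam X) (lam Y) - dot X Y)] }.

Hypothesis sys : spectral_system.

Lemma dot_mulmx_tr (A : 'M[R]_n) x y : dot (A *m x : 'E[R]_n) y = dot x (A^T *m y : 'E[R]_n).
Proof. by rewrite /dot /= /mxdot trmx_mul -mulmxA. Qed.

Lemma dot_orth i x y : dot (Q i *m x : 'E[R]_n) (Q i *m y : 'E[R]_n) = dot x y.
Proof.
by rewrite dot_mulmx_tr mulmxA (mulmx1C (sys_orth sys i)) mul1mx.
Qed.

Lemma frame_dist Phi Psi x y : spectral_frame Phi Psi ->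
  `|Phi x - Phi y| = `|x - y|.
Proof.
move=> fr; apply/eqP; rewrite -(@eqrXn2 _ 2)//.
by rewrite !sqr_normB !sqr_norm_dot !(frame_iso fr).
Qed.

Lemma frame_decomposition X :
  exists Phi Psi, spectral_frame Phi Psi /\ X = Phi (lam X).
Proof.
have [C H] := sys_frame sys X `|X|.
by have [Phi [Psi [fr XE _]]] := H X (lexx _); exists Phi, Psi.
Qed.

Lemma norm_lam X : `|lam X| = `|X|.
Proof.
have [Phi [Psi [fr XE]]] := frame_decomposition X.
by rewrite !eucnormE [in RHS]XE (frame_iso fr).
Qed.

(** The Hoffman-Wielandt inequality: the trace inequality and the equality of
    norms leave only the cross term to compare. *)
Lemma lam_dist X Y : `|lam X - lam Y| <= `|X - Y|.
Proof.
rewrite -ler_sqr ?nnegrE// !sqr_normB !norm_lam lerD2l lerN2 ler_pM2l//.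
exact: sys_trace.
Qed.

Variable g : 'E[R]_n -> \bar R.
Hypothesis g_proper : proper g.
Hypothesis g_sym : forall i x, g (Q i *m x) = g x.

Lemma g_sym_tr i x : g ((Q i)^T *m x) = g x.
Proof. by rewrite -(g_sym i) mulmxA (sys_orth sys) mul1mx. Qed.

Lemma conjugate_sym i y : conjugate g (Q i *m y) = conjugate g y.
Proof.
apply/eqP; rewrite eq_le; apply/andP; split; apply: ge_ereal_sup => _ [x _ <-].
  rewrite -(g_sym_tr i) (_ : dot x _ = dot ((Q i)^T *m x : 'E[R]_n) y).
    exact: fenchel_young.
  by rewrite dot_mulmx_tr trmxK.
by rewrite -(g_sym i) -(dot_orth i); exact: fenchel_young.
Qed.

(** Von Neumann's formula: the conjugate of a spectral function is the spectral
    function of the conjugate. *)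
Lemma conjugate_spectral Y : conjugate (g \o lam) Y = conjugate g (lam Y).
Proof.
apply/eqP; rewrite eq_le; apply/andP; split; apply: ge_ereal_sup => _ [x _ <-].
  apply: le_trans (fenchel_young _ (lam x) _).
  by rewrite leeD2r// lee_fin sys_trace.
have [Phi [Psi [fr YE]]] := frame_decomposition Y.
apply: le_trans (fenchel_young _ (Phi x) _).
have [i /= ->] := frame_lam fr x.
by rewrite g_sym [in leRHS]YE (frame_iso fr).
Qed.

(** Taking the diagonal decreases a convex spectral function; for a conjugate this
    is immediate, since restricting the supremum to the range of the frame gives
    the value at the diagonal. *)
Lemma conjugate_frame_adj_le Phi Psi Y : spectral_frame Phi Psi ->
  (conjugate g (Psi Y) <= conjugate (g \o lam) Y)%E.
Proof.
move=> fr; apply: ge_ereal_sup => _ [x _ <-].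
apply: le_trans (fenchel_young _ (Phi x) _).
by have [i /= ->] := frame_lam fr x; rewrite g_sym (frame_adj fr).
Qed.

(** Let [v] be the spectrum of [Xbar] and let the frame [Phi] be adapted to [Xbar]
    and [Y]. By the Fenchel-Young inequality the gap in the trace inequality for
    [Xbar] and [Y] is at most the excess [r], hence [Y] is close to its diagonal
    part [Phi (Psi Y)]. By [conjugate_frame_adj_le] the excess of [conjugate g]
    at the diagonal [Psi Y] is at most [r] too, which bounds the distance of
    [Psi Y] to the points [z] having [v] as a subgradient, and [Phi] maps such
    points into the subdifferential at [Xbar].

    The subgradient [Y0] gives the Fenchel equality at [Xbar], and with it the
    passage between subgradients of a function and of its conjugate. *)
Lemma spectral_growth Xbar Ybar Y0 (c : R) :
    proper (g \o lam) ->
    subdifferential (g \o lam) Xbar Y0 ->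
    conjugate (g \o lam) Ybar = c%:E ->
    subdifferential (conjugate (g \o lam)) Ybar Xbar ->
    (forall v, subdifferential (conjugate g) (lam Ybar) v ->
      metrically_subregular (subdifferential (conjugate g)) (lam Ybar) v) ->
  exists2 eps : R, 0 < eps & forall Y r, `|Y - Ybar| <= eps ->
    (conjugate (g \o lam) Y <= (c + dot Xbar (Y - Ybar) + r)%:E)%E ->
    exists2 W, subdifferential (g \o lam) Xbar W & eps * `|Y - W| ^+ 2 <= r.
Proof.
move=> thp subY0 thYbar subX subreg.
set theta := g \o lam in thp subY0 thYbar subX *.
have [a thX] := subdifferential_fin thp subY0.
set v := lam Xbar; set ybar := lam Ybar.
have gv : g v = a%:E by exact: thX.
have cE : c = dot Xbar Ybar - a.
  apply/le_anti/andP; split; last first.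
    by rewrite -lee_fin -thYbar fenchel_young_fin.
  have := subX Y0; rewrite (conjugate_of_subdifferential thp thX subY0) thYbar.
  by rewrite -EFinD lee_fin dotBr; lra.
have gybar : conjugate g ybar = c%:E by rewrite -conjugate_spectral.
have FY i : dot (Q i *m v : 'E[R]_n) ybar <= c + a.
  by rewrite -lerBlDr -lee_fin -gybar fenchel_young_fin// g_sym.
have XY : dot Xbar Ybar = dot v ybar.
  apply/le_anti; rewrite sys_trace//=.
  have : dot v ybar - a <= c by rewrite -lee_fin -gybar fenchel_young_fin.
  by rewrite cE; lra.
(* [Psi Y] need not be ordered: for some [i] the spectrum [Q i *m Psi Y] of its
   image is close to [ybar], and then the relevant subgradient is [Q i *m v].
   The other indices satisfy [dot (Q i *m v) ybar < dot v ybar]; they are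
   finitely many, so the difference is bounded below by a positive [e]. *)
pose tight i := dot (Q i *m v : 'E[R]_n) ybar = dot v ybar.
have [e e0 He] : exists2 e : R, 0 < e & forall i,
    dot (Q i *m v : 'E[R]_n) ybar + e <= dot v ybar \/ tight i /\
    forall y r, `|y - ybar| <= e ->
    (conjugate g y <= (c + dot (Q i *m v : 'E[R]_n) (y - ybar) + r)%:E)%E ->
    exists2 z, subdifferential (conjugate g) z (Q i *m v) & e * `|y - z| ^+ 2 <= r.
  apply: finite_positive_bound => i.
  have [ti|ti] := pselect (tight i).
    have giv : g (Q i *m v) = a%:E by rewrite g_sym.
    have subi : subdifferential (conjugate g) ybar (Q i *m v).
      apply: (@subdifferential_conjugate _ _ _ _ _ a) => //.
      by rewrite gybar lee_fin ti cE XY.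
    have [e e0 He] := growth_of_metric_subregularity g_proper gybar subi (subreg _ subi).
    exists e => // e' e'0 e'e; right; split => // y r ye gy.
    have [z subz ez] := He y r (le_trans ye e'e) gy.
    by exists z => //; apply: le_trans ez; rewrite ler_wpM2r ?sqr_ge0.
  exists (dot v ybar - dot (Q i *m v : 'E[R]_n) ybar) => [|e' _]; last first.
    by move=> ?; left; lra.
  rewrite subr_gt0 lt_neqAle; apply/andP; split; first exact/eqP.
  by have := FY i; rewrite cE XY; lra.
have [C0 HC0] := sys_frame sys Xbar (`|Ybar| + 1).
pose C := `|C0| + 1.
have C1 : 0 < C by rewrite ltr_wpDl.
have v1 : 0 < `|v| + 1 by rewrite ltr_wpDl.
(* [dl] is chosen so that [Y] within [dl] of [Ybar] gives [`|Y - Phi (Psi Y)| <= b],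
   hence [Q i *m Psi Y] within [2 * b] of [ybar] *)
pose b := Num.min (e / 2) (e / (4 * (`|v| + 1))).
have b0 : 0 < b by rewrite lt_min !divr_gt0// mulr_gt0.
have be1 : b <= e / 2 by rewrite ge_min lexx.
have be2 : 4 * ((`|v| + 1) * b) <= e.
  rewrite mulrA mulrC -ler_pdivlMr ?mulr_gt0//.
  by rewrite ge_min lexx orbT.
pose dl := Num.min (Num.min 1 b) (b ^+ 2 / (2 * C * (`|v| + 1))).
have dl0 : 0 < dl by rewrite lt_min divr_gt0 ?exprn_gt0 ?mulr_gt0// lt_min ltr01 b0.
have dl1 : dl <= 1 by rewrite ge_min ge_min lexx.
have dlb : dl <= b by rewrite ge_min ge_min lexx orbT.
have dlb2 : 2 * C * (`|v| + 1) * dl <= b ^+ 2.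
  by rewrite mulrC -ler_pdivlMr ?mulr_gt0// ge_min lexx orbT.
pose K := 2 * (C + e^-1).
have K0 : 0 < K by rewrite mulr_gt0// addr_gt0// invr_gt0.
exists (Num.min dl K^-1); first by rewrite lt_min dl0 invr_gt0.
move=> Y r; rewrite le_min => /andP[Ydl _] thY.
have [|Phi [Psi [fr XE]]] := HC0 Y.
  rewrite -[Y](subrK Ybar) addrC (le_trans (ler_normD _ _))// lerD2l.
  exact: le_trans dl1.
set D := _ - dot Xbar Y; move=> HD.
have D0 : 0 <= D by rewrite subr_ge0 sys_trace.
have {}HD : `|Y - Phi (Psi Y)| ^+ 2 <= C * D.
  apply: le_trans HD _; rewrite ler_wpM2r// (le_trans (ler_norm _))//.
  by rewrite lerDl.
have Dr : D <= r.
  have := le_trans (fenchel_young_fin Y thX) thY; rewrite lee_fin.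
  have := fenchel_young_fin (lam Y) gv; rewrite -conjugate_spectral.
  move=> /le_trans /(_ thY); rewrite lee_fin /D -/v dotBr cE; lra.
have Dsmall : D <= 2 * (`|v| + 1) * dl.
  have -> : D = dot v (lam Y - ybar) - dot Xbar (Y - Ybar).
    by rewrite /D !dotBr XY -/v; lra.
  have vdl : `|v| * `|Y - Ybar| <= (`|v| + 1) * dl.
    by apply: ler_pM; rewrite ?lerDl.
  rewrite -mulrA mulr2n mulrDl mul1r lerD//.
    rewrite (le_trans (dot_le_norm _ _))// (le_trans _ vdl)// ler_wpM2l//.
    exact: lam_dist.
  by rewrite -dotNr (le_trans (dot_le_norm _ _))// normrN -norm_lam.
have Yb : `|Y - Phi (Psi Y)| <= b.
  rewrite -ler_sqr ?nnegrE ?(ltW b0)//; apply: le_trans HD _.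
  apply: le_trans dlb2; rewrite -!mulrA [leRHS]mulrCA ler_pM2l//.
  by rewrite (le_trans Dsmall)// -!mulrA.
have [i iE] := frame_lam fr (Psi Y).
have vPsi : dot (Q i *m v : 'E[R]_n) (Q i *m Psi Y : 'E[R]_n) = dot Xbar Y.
  by rewrite dot_orth -(frame_adj fr) -XE.
have near_ybar : `|(Q i *m Psi Y : 'E[R]_n) - ybar| <= 2 * b.
  rewrite -iE (le_trans (lam_dist _ _))// -[_ - Ybar](subrKA Y).
  rewrite (le_trans (ler_normD _ _))// distrC.
  by have := le_trans Ydl dlb; lra.
have [notight|[ti Hi]] := He i.
  exfalso.
  have h1 : dot v ybar - (`|v| + 1) * b <= dot Xbar Y.
    rewrite -XY -[Y](subrK Ybar) dotDr.
    have : - dot Xbar (Y - Ybar) <= (`|v| + 1) * b; last by lra.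
    rewrite -dotNr (le_trans (dot_le_norm _ _))// normrN -norm_lam -/v.
    by apply: ler_pM; rewrite ?lerDl//; exact: le_trans Ydl dlb.
  have h2 : dot Xbar Y <= dot (Q i *m v : 'E[R]_n) ybar + (`|v| + 1) * (2 * b).
    rewrite -vPsi -[(Q i *m Psi Y : 'E[R]_n)](subrK ybar) dotDr addrC lerD2l.
    rewrite (le_trans (dot_le_norm _ _))//; apply: ler_pM => //.
    by rewrite eucnormE dot_orth -eucnormE lerDl.
  have vb0 : 0 < (`|v| + 1) * b by rewrite mulr_gt0.
  by have : dot v ybar < dot v ybar; [lra|rewrite ltxx].
have be : 2 * b <= e by lra.
have [|z subz ez] := Hi (Q i *m Psi Y) r (le_trans near_ybar be).
  rewrite conjugate_sym (le_trans (conjugate_frame_adj_le Y fr))//.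
  apply: le_trans thY _; rewrite lee_fin !dotBr ti vPsi XY; lra.
exists (Phi ((Q i)^T *m z)).
  apply: (subdifferential_of_conjugate thp thX).
  have [j jE] := frame_lam fr ((Q i)^T *m z).
  rewrite conjugate_spectral jE conjugate_sym -(conjugate_sym i).
  rewrite mulmxA (sys_orth sys) mul1mx.
  have gz := subz ybar; rewrite gybar in gz.
  rewrite {1}XE (frame_iso fr) dotC -/v.
  have -> : dot ((Q i)^T *m z : 'E[R]_n) v = dot z (Q i *m v : 'E[R]_n).
    by rewrite dot_mulmx_tr trmxK.
  move: gz; have := conjugate_gtNy z g_proper.
  case: (conjugate g z) => [d| |]// _; rewrite -EFinD !lee_fin dotBr ti.
  by rewrite (dotC z) cE XY; lra.
have Yz : `|Y - Phi ((Q i)^T *m z)| <=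
    `|Y - Phi (Psi Y)| + `|(Q i *m Psi Y : 'E[R]_n) - z|.
  rewrite -[_ - Phi (_ *m z)](subrKA (Phi (Psi Y))) (le_trans (ler_normD _ _))//.
  rewrite lerD2l (frame_dist _ _ fr).
  have -> : (Q i *m Psi Y : 'E[R]_n) - z = Q i *m (Psi Y - (Q i)^T *m z).
    by rewrite mulmxBr mulmxA (sys_orth sys) mul1mx.
  by rewrite !eucnormE dot_orth.
have r0 : 0 <= r by exact: le_trans Dr.
have Yz2 : `|Y - Phi ((Q i)^T *m z)| ^+ 2 <= K * r.
  apply: (@le_trans _ _ ((`|Y - Phi (Psi Y)| + `|(Q i *m Psi Y : 'E[R]_n) - z|) ^+ 2)).
    by rewrite lerXn2r ?nnegrE// addr_ge0.
  have h1 : `|Y - Phi (Psi Y)| ^+ 2 <= C * r.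
    by apply: le_trans HD _; rewrite ler_pM2l.
  have h2 : `|(Q i *m Psi Y : 'E[R]_n) - z| ^+ 2 <= e^-1 * r.
    by rewrite ler_pdivlMl.
  have -> : K * r = 2 * (C * r + e^-1 * r) by rewrite /K; ring.
  apply: (le_trans (sqrD_le _ _)); lra.
apply: (@le_trans _ _ (K^-1 * (K * r))); last by rewrite mulKf ?gt_eqF.
apply: ler_pM => //; last by rewrite ge_min lexx orbT.
by rewrite le_min (ltW dl0) invr_ge0 ltW.
Qed.

End spectral_systems.

(** * Plane rotations *)

Section plane_rotations.
Variable R : realType.

(** The left-hand side of the hypothesis has maximum
    [Num.sqrt (A ^+ 2 + B ^+ 2) - A] over the unit circle. *)
Lemma circle_gain (A B D : R) :
    (forall c s, c ^+ 2 + s ^+ 2 = 1 -> A * (c - 1) + B * s <= D) ->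
  B ^+ 2 <= (2 * `|A| + D) * D.
Proof.
move=> H; have D0 : 0 <= D.
  by have := H 1 0; rewrite subrr !mulr0 addr0 expr1n expr0n addr0; apply.
pose r := Num.sqrt (A ^+ 2 + B ^+ 2).
have r2 : r ^+ 2 = A ^+ 2 + B ^+ 2 by rewrite sqr_sqrtr// addr_ge0 ?sqr_ge0.
have AD : A * D <= `|A| * D by rewrite ler_wpM2r// ler_norm.
have [r0|rN0] := eqVneq r 0.
  move: r2; rewrite r0 expr0n /= => AB.
  have -> : B ^+ 2 = 0.
    by have := sqr_ge0 A; have := sqr_ge0 B; lra.
  by rewrite mulr_ge0// addr_ge0// mulr_ge0.
have r0 : 0 < r by rewrite lt_def rN0 sqrtr_ge0.
have /H : (A / r) ^+ 2 + (B / r) ^+ 2 = 1.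
  by rewrite !expr_div_n -mulrDl -r2 divff// expf_neq0.
have -> : A * (A / r - 1) + B * (B / r) = r - A.
  rewrite -[r in RHS](mulfK rN0) -expr2 r2; field.
  by rewrite rN0.
rewrite lerBlDl => rAD.
have : r ^+ 2 <= (A + D) ^+ 2 by rewrite lerXn2r ?nnegrE//; lra.
rewrite r2 sqrrD; nra.
Qed.

(** The form in which the gain of a rotation acting on both sides appears:
    doubling the angle brings it to the form of [circle_gain]. *)
Lemma circle_gain_double (A B D : R) :
    (forall c s, c ^+ 2 + s ^+ 2 = 1 -> - (2 * A) * s ^+ 2 + 2 * B * (c * s) <= D) ->
  B ^+ 2 <= (2 * `|A| + D) * D.
Proof.
move=> H; apply: circle_gain => c s cs.
have s2 : s ^+ 2 = 1 - c ^+ 2 by lra.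
have c1 : -1 <= c <= 1 by have := sqr_ge0 s; nra.
pose a := Num.sqrt ((1 + c) / 2); pose b := Num.sqrt ((1 - c) / 2).
have a2 : a ^+ 2 = (1 + c) / 2 by rewrite sqr_sqrtr//; lra.
have b2 : b ^+ 2 = (1 - c) / 2 by rewrite sqr_sqrtr//; lra.
have ab : 2 * (a * b) = `|s|.
  apply/eqP; rewrite -(@eqrXn2 _ 2)// ?mulr_ge0 ?sqrtr_ge0//.
  rewrite real_normK ?num_real// !exprMn a2 b2 s2.
  by apply/eqP; field.
pose b' := if s < 0 then - b else b.
have b'2 : b' ^+ 2 = b ^+ 2 by rewrite /b'; case: ifP; rewrite ?sqrrN.
have ab' : 2 * (a * b') = s.
  rewrite /b'; case: (ltP s 0) => s0; last by rewrite ab ger0_norm.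
  by rewrite !mulrN ab ltr0_norm// opprK.
have /H : a ^+ 2 + b' ^+ 2 = 1 by rewrite b'2 a2 b2; lra.
by rewrite b'2 b2 -ab'; lra.
Qed.

Variables (n : nat).

Definition givens (i j : 'I_n) (c s : R) : 'M[R]_n := \matrix_(k, l)
  if k == i then (if l == i then c else if l == j then s else 0)
  else if k == j then (if l == i then - s else if l == j then c else 0)
  else (k == l)%:R.

Lemma givens_mulE i j c s p (Y : 'M[R]_(n, p)) k l : i != j ->
  (givens i j c s *m Y) k l =
    if k == i then c * Y i l + s * Y j l
    else if k == j then - s * Y i l + c * Y j l else Y k l.
Proof.
move=> ij; rewrite mxE.
have [->|ki] := eqVneq k i.
  rewrite (bigD1 i)//= (bigD1 j) 1?eq_sym//= big1 ?addr0.
    by rewrite !mxE !eqxx eq_sym (negPf ij).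
  by move=> r /andP[ri rj]; rewrite mxE eqxx (negPf ri) (negPf rj) mul0r.
have [->|kj] := eqVneq k j.
  rewrite (bigD1 i)//= (bigD1 j) 1?eq_sym//= big1 ?addr0.
    by rewrite !mxE !eqxx eq_sym (negPf ij).
  by move=> r /andP[ri rj]; rewrite mxE eqxx eq_sym (negPf ij) (negPf ri) (negPf rj) mul0r.
rewrite (bigD1 k)//= big1 ?addr0.
  by rewrite mxE (negPf ki) (negPf kj) eqxx mul1r.
by move=> r rk; rewrite mxE (negPf ki) (negPf kj) eq_sym (negPf rk) mul0r.
Qed.

Lemma mul_givens_trE i j c s p (Y : 'M[R]_(p, n)) k l : i != j ->
  (Y *m (givens i j c s)^T) k l =
    if l == i then c * Y k i + s * Y k j
    else if l == j then - s * Y k i + c * Y k j else Y k l.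
Proof.
move=> ij; have -> : Y *m (givens i j c s)^T = (givens i j c s *m Y^T)^T.
  by rewrite trmx_mul trmxK.
by rewrite mxE givens_mulE// !mxE.
Qed.

Lemma givens_orth i j c s : i != j -> c ^+ 2 + s ^+ 2 = 1 ->
  givens i j c s *m (givens i j c s)^T = 1%:M.
Proof.
move=> ij cs; apply/matrixP => k l; rewrite mul_givens_trE// !mxE !eqxx.
rewrite (eq_sym j i) (negPf ij).
have ji : (j == i) = false by rewrite eq_sym (negPf ij).
have cs' : c * c + s * s = 1 by rewrite -!expr2.
have [li|li] := eqVneq l i; [subst l|have [lj|lj] := eqVneq l j; [subst l|]].
- have [ki|ki] := eqVneq k i; first by subst k.
  have [kj|kj] := eqVneq k j; last by rewrite !mulr0 addr0.
  by subst k; rewrite ?ji mulr0n; ring.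
- have [ki|ki] := eqVneq k i; first by subst k; rewrite ?(negPf ij) mulr0n; ring.
  have [kj|kj] := eqVneq k j; last by rewrite !mulr0 addr0.
  by subst k; rewrite mulrNN addrC.
- have [ki|ki] := eqVneq k i; first by subst k; rewrite eq_sym (negPf li).
  have [kj|//] := eqVneq k j.
  by subst k; rewrite eq_sym (negPf lj).
Qed.

Definition flip (i : 'I_n) : 'M[R]_n :=
  \matrix_(k, l) ((-1) ^+ (k == i) * (k == l)%:R).

Lemma flip_mulE i p (Y : 'M[R]_(n, p)) k l :
  (flip i *m Y) k l = (-1) ^+ (k == i) * Y k l.
Proof.
rewrite mxE (bigD1 k)//= big1 ?addr0; first by rewrite mxE eqxx mulr1.
by move=> r rk; rewrite mxE [k == r]eq_sym (negPf rk) mulr0 mul0r.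
Qed.

Lemma flip_orth i : flip i *m (flip i)^T = 1%:M.
Proof.
apply/matrixP => k l; rewrite flip_mulE !mxE [l == k]eq_sym.
by have [->|_] := eqVneq k l; rewrite ?mulr0// mulr1 -signr_addb addbb.
Qed.

End plane_rotations.

Section rectangular_diagonal.
Variables (R : realType) (n m : nat) (pos : 'I_n -> 'I_m).
Hypothesis pos_inj : injective pos.
Implicit Types (x u : 'E[R]_n) (Y Z : euc 'M[R]_(n, m)).

(** In the applications [pos] is the identity for symmetric matrices and the
    inclusion of indices for rectangular ones. *)
Definition rdiag x : euc 'M[R]_(n, m) := \matrix_(i, k) (x i 0 *+ (k == pos i)).

Definition mdiag Y : 'E[R]_n := \col_i Y i (pos i).

Lemma mdiagE Y i : mdiag Y i 0 = Y i (pos i).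
Proof. by rewrite mxE. Qed.

Lemma vdotE x u : dot x u = \sum_i x i 0 * u i 0.
Proof. by rewrite mx_dotE; apply: eq_bigr => i _; rewrite big_ord1. Qed.

Lemma rdiag_mdiag_dot x Y : dot (rdiag x) Y = dot x (mdiag Y).
Proof.
rewrite mx_dotE vdotE; apply: eq_bigr => i _.
rewrite (bigD1 (pos i))//= !mxE eqxx mulr1n big1 ?addr0// => k /negPf ki.
by rewrite mxE ki mulr0n mul0r.
Qed.

Lemma rdiagK x : mdiag (rdiag x) = x.
Proof. by apply/colP => i; rewrite !mxE eqxx mulr1n. Qed.

Lemma dot_mdiag_change2 u Y Z i j : i != j ->
    (forall k, k != i -> k != j -> Z k (pos k) = Y k (pos k)) ->
  dot u (mdiag Z) - dot u (mdiag Y) =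
    u i 0 * (Z i (pos i) - Y i (pos i)) + u j 0 * (Z j (pos j) - Y j (pos j)).
Proof.
move=> ij H; rewrite !vdotE -sumrB (bigD1 i)//= (bigD1 j) 1?eq_sym//= big1.
  by rewrite !mxE addr0; ring.
by move=> k /andP[ki kj]; rewrite !mxE H// subrr.
Qed.

Lemma gain_left u Y (i j : 'I_n) c s : i != j ->
  dot u (mdiag (givens i j c s *m Y)) - dot u (mdiag Y) =
    (u i 0 * Y i (pos i) + u j 0 * Y j (pos j)) * (c - 1)
    + (u i 0 * Y j (pos i) - u j 0 * Y i (pos j)) * s.
Proof.
move=> ij; rewrite (dot_mdiag_change2 u ij) => [|k ki kj].
  by rewrite !givens_mulE// !eqxx (eq_sym j) (negPf ij); ring.
by rewrite givens_mulE// (negPf ki) (negPf kj).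
Qed.

Lemma gain_right u Y (i j : 'I_n) c s : i != j ->
  dot u (mdiag (Y *m (givens (pos i) (pos j) c s)^T)) - dot u (mdiag Y) =
    (u i 0 * Y i (pos i) + u j 0 * Y j (pos j)) * (c - 1)
    + (u i 0 * Y i (pos j) - u j 0 * Y j (pos i)) * s.
Proof.
move=> ij; have pij : pos i != pos j by rewrite (inj_eq pos_inj).
rewrite (dot_mdiag_change2 u ij) => [|k ki kj].
  by rewrite !mul_givens_trE// !eqxx (eq_sym (pos j)) (negPf pij); ring.
by rewrite mul_givens_trE// !(inj_eq pos_inj) (negPf ki) (negPf kj).
Qed.

Lemma gain_outside u Y (i : 'I_n) (k : 'I_m) c s : (forall j, k != pos j) ->
  dot u (mdiag (Y *m (givens (pos i) k c s)^T)) - dot u (mdiag Y) =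
    (u i 0 * Y i (pos i)) * (c - 1) + (u i 0 * Y i k) * s.
Proof.
move=> kpos; have ik : pos i != k by rewrite eq_sym.
rewrite !vdotE -sumrB (bigD1 i)//= big1 ?addr0.
  by rewrite !mdiagE mul_givens_trE// eqxx; ring.
move=> j ji; rewrite !mdiagE mul_givens_trE// (inj_eq pos_inj) (negPf ji).
by rewrite eq_sym (negPf (kpos j)) subrr.
Qed.

Lemma gain_both u Y (i j : 'I_n) c s : i != j -> c ^+ 2 + s ^+ 2 = 1 ->
  dot u (mdiag (givens i j c s *m Y *m (givens (pos i) (pos j) c s)^T))
    - dot u (mdiag Y) =
    - ((u i 0 - u j 0) * (Y i (pos i) - Y j (pos j))) * s ^+ 2
    + (u i 0 - u j 0) * (Y i (pos j) + Y j (pos i)) * (c * s).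
Proof.
move=> ij cs; have pij : pos i != pos j by rewrite (inj_eq pos_inj).
rewrite (dot_mdiag_change2 u ij) => [|k ki kj].
  rewrite !mul_givens_trE// !givens_mulE// !eqxx.
  rewrite (eq_sym (pos j)) (negPf pij) (eq_sym j) (negPf ij).
  have c2 : c * c = 1 - s * s by have := cs; rewrite !expr2 => <-; ring.
  transitivity (u i 0 * ((c * c) * Y i (pos i) + c * s * (Y i (pos j) + Y j (pos i))
     + s * s * Y j (pos j) - Y i (pos i)) + u j 0 * ((c * c) * Y j (pos j)
     - c * s * (Y i (pos j) + Y j (pos i)) + s * s * Y i (pos i) - Y j (pos j))).
    by ring.
  by rewrite c2; ring.
rewrite mul_givens_trE// !(inj_eq pos_inj) (negPf ki) (negPf kj).
by rewrite givens_mulE// (negPf ki) (negPf kj).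
Qed.

Lemma dot_rect_adj p q (U : 'M[R]_(p, n)) (V : 'M[R]_(q, m))
    (Z : 'M[R]_(p, q)) (Y : 'M[R]_(n, m)) :
  dot (U^T *m Z *m V) Y = dot Z (U *m Y *m V^T).
Proof.
rewrite /dot /= /mxdot !trmx_mul trmxK -(mulmxA V^T) mxtrace_mulC.
by rewrite !mulmxA.
Qed.

End rectangular_diagonal.

(** * Frames from the maximization of a functional of the diagonal *)

Section entrywise_continuity.
Variables (R : realType) (T : topologicalType).

Definition entrywise_continuous m n (F : T -> 'M[R]_(m, n)) :=
  forall i j, continuous (fun t => F t i j : R).

Lemma entrywise_mul m n p (F : T -> 'M[R]_(m, n)) (G : T -> 'M[R]_(n, p)) :
  entrywise_continuous F -> entrywise_continuous G ->
  entrywise_continuous (fun t => F t *m G t).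
Proof.
move=> cF cG i j.
rewrite (_ : (fun t => (F t *m G t) i j) =
    fun t => \sum_k (F t i k * G t k j : R^o)); last first.
  by apply/funext => t; rewrite mxE.
apply: continuous_big => [|k _ t]; first exact: add_continuous.
by apply: continuousM; [exact: cF|exact: cG].
Qed.

Lemma entrywise_tr m n (F : T -> 'M[R]_(m, n)) :
  entrywise_continuous F -> entrywise_continuous (fun t => (F t)^T).
Proof.
move=> cF i j; rewrite (_ : (fun t => (F t)^T i j) = fun t => F t j i).
  exact: cF.
by apply/funext => t; rewrite mxE.
Qed.

Lemma entrywise_cst m n (A : 'M[R]_(m, n)) : entrywise_continuous (fun=> A).
Proof. by move=> i j; exact: cst_continuous. Qed.

Lemma entrywise_dot m n (A : 'M[R]_(m, n)) (F : T -> 'M[R]_(m, n)) :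
  entrywise_continuous F -> continuous (fun t => dot A (F t) : R).
Proof.
move=> cF; rewrite (_ : (fun t => dot A (F t)) =
    fun t => \sum_i \sum_j (A i j * F t i j : R^o)); last first.
  by apply/funext => t; rewrite (mx_dotE (A : euc _)).
apply: continuous_big => [|i _]; first exact: add_continuous.
apply: continuous_big => [|j _ t]; first exact: add_continuous.
by apply: continuousM; [exact: cst_continuous|exact: cF].
Qed.

Lemma entrywise_closed_eq m n (A : 'M[R]_(m, n)) (F : T -> 'M[R]_(m, n)) :
  entrywise_continuous F -> closed [set t | F t = A].
Proof.
move=> cF; rewrite (_ : [set t | F t = A] =
    \bigcap_(ij in [set: 'I_m * 'I_n])
      ((fun t => F t ij.1 ij.2) @^-1` [set x : R | x = A ij.1 ij.2])).
  apply: closed_bigI => -[i j] _; apply: preimage_closed; last exact: closed_eq.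
  by move=> t _; exact: cF.
apply/seteqP; split=> [t /= FtA [i j] _|t /= H]; first by rewrite /= FtA.
by apply/matrixP => i j; exact: (H (i, j)).
Qed.

End entrywise_continuity.

Section orthogonal_pairs.
Variables (R : realType) (n m : nat) (pos : 'I_n -> 'I_m).
Hypothesis pos_inj : injective pos.
Variable G : 'M[R]_n -> 'M[R]_m -> Prop.
Implicit Types (x v c : 'E[R]_n) (X Y : euc 'M[R]_(n, m)).
Implicit Types (J U : 'M[R]_n) (K V : 'M[R]_m).

(** The pairs act by [Y |-> J *m Y *m K^T]: all pairs of orthogonal matrices for
    singular values, the pairs of equal ones for eigenvalues. *)
Record orthogonal_pair_group := OrthogonalPairGroup {
  pair_orthl : forall J K, G J K -> J *m J^T = 1%:M;
  pair_orthr : forall J K, G J K -> K *m K^T = 1%:M;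
  pair_one : G 1%:M 1%:M;
  pair_mul : forall J K J' K', G J K -> G J' K' -> G (J *m J') (K *m K');
  pair_closed : closed [set p : euc 'M[R]_n * euc 'M[R]_m | G p.1 p.2] }.

Hypothesis GG : orthogonal_pair_group.

Lemma norm_orth p (U : 'M[R]_p) : U *m U^T = 1%:M ->
  `|U : euc 'M[R]_p| = Num.sqrt p%:R.
Proof.
by move=> UU; rewrite eucnormE /dot /= /mxdot mxtrace_mulC UU mxtrace1.
Qed.

Lemma pair_compact : compact [set p : euc 'M[R]_n * euc 'M[R]_m | G p.1 p.2].
Proof.
have r0 p : 0 < Num.sqrt p%:R + 1 :> R by rewrite ltr_wpDl.
have ballc p := closed_ball_mx_compact (x := 0 : euc 'M[R]_p) (r0 p).
apply: (subclosed_compact (pair_closed GG) (compact_setX (ballc n) (ballc m))).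
move=> [U V] /= UV; split => /=; rewrite closed_ball_eucE//= sub0r normrN.
  by rewrite (norm_orth (pair_orthl GG UV)) lerDl.
by rewrite (norm_orth (pair_orthr GG UV)) lerDl.
Qed.

(** The frames in which [X] has the diagonal [v] form a compact set. *)
Lemma orbit_maximizer v X c Y :
    (exists U V, G U V /\ X = U^T *m rdiag pos v *m V) ->
  exists U V, [/\ G U V, X = U^T *m rdiag pos v *m V &
    forall U' V', G U' V' -> X = U'^T *m rdiag pos v *m V' ->
      dot c (mdiag pos (U' *m Y *m V'^T)) <= dot c (mdiag pos (U *m Y *m V^T))].
Proof.
move=> [U0 [V0 [G0 X0]]].
pose T := (euc 'M[R]_n * euc 'M[R]_m)%type.
have c1 : entrywise_continuous (fun p : T => p.1 : 'M[R]_n).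
  by move=> i j p; apply: (@continuous_comp _ _ _ fst (fun U : euc 'M[R]_n => U i j));
    [exact: cvg_fst|exact: entry_continuous].
have c2 : entrywise_continuous (fun p : T => p.2 : 'M[R]_m).
  by move=> i j p; apply: (@continuous_comp _ _ _ snd (fun U : euc 'M[R]_m => U i j));
    [exact: cvg_snd|exact: entry_continuous].
pose S := [set p : T | G p.1 p.2] `&`
  [set p : T | (p.1 : 'M[R]_n)^T *m rdiag pos v *m (p.2 : 'M[R]_m) = X].
have Sc : compact S.
  apply: compact_closedI; last first.
    apply: (@entrywise_closed_eq _ T _ _ X (fun p : T => (p.1 : 'M[R]_n)^T *m rdiag pos v *m (p.2 : 'M[R]_m))).
    apply: entrywise_mul => //; apply: entrywise_mul; first exact: entrywise_tr.
    exact: entrywise_cst.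
  exact: pair_compact.
pose f (p : T) := dot (rdiag pos c) ((p.1 : 'M[R]_n) *m (Y : 'M[R]_(n, m)) *m (p.2 : 'M[R]_m)^T).
have fc : continuous f.
  apply: entrywise_dot; apply: entrywise_mul; last exact: entrywise_tr.
  by apply: entrywise_mul => //; exact: entrywise_cst.
have [|[U V] + H] := compact_EVT_max _ Sc (continuous_subspaceT fc).
  by exists (U0, V0); split.
rewrite inE => -[/= GUV XUV]; exists U, V; split => // U' V' G' X'.
rewrite -!rdiag_mdiag_dot; apply: (H (U', V')).
by rewrite inE.
Qed.

Variables (chamber strict : set 'E[R]_n) (space : set (euc 'M[R]_(n, m))).
Variables (lam : euc 'M[R]_(n, m) -> 'E[R]_n) (cc : 'E[R]_n).

(** Here [chamber] is the cone of the ordered vectors, [strict] the set of the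
    strictly ordered ones, and [lam] gives the ordered spectrum of the elements of
    [space]. The fields [chamber_max] and [offdiag_max] say what maximality along
    an orbit of the group forces on the diagonal and off the diagonal. In the
    latter, no element of the group gains more than [D] for [v], and the
    stabilizer of [v] gains nothing for [c], which separates the entries that [v]
    does not. *)
Record chamber_system := ChamberSystem {
  chamber0 : chamber 0;
  chamber_strict : forall x eps, chamber x -> 0 < eps -> strict (eps *: cc + x);
  space_act : forall J K Y, G J K -> space Y -> space (J *m Y *m K^T);
  lam_frame : forall U V x, G U V -> chamber x ->
    lam (U^T *m rdiag pos x *m V) = x;
  chamber_max : forall c Y, strict c -> space Y ->
    (forall J K, G J K -> dot c (mdiag pos (J *m Y *m K^T)) <= dot c (mdiag pos Y)) ->
    chamber (mdiag pos Y);
  offdiag_max : forall c v, strict c -> chamber v -> exists2 C : R, 0 <= C &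
    forall Y D, space Y -> 0 <= D ->
    (forall J K, G J K ->
      dot v (mdiag pos (J *m Y *m K^T)) <= dot v (mdiag pos Y) + D) ->
    (forall J K, G J K -> J^T *m rdiag pos v *m K = rdiag pos v ->
      dot c (mdiag pos (J *m Y *m K^T)) <= dot c (mdiag pos Y)) ->
    forall i k, k != pos i -> Y i k ^+ 2 <= C * ((4 * `|v| * `|Y| + D) * D) }.

Hypothesis CS : chamber_system.

Lemma strict_cc : strict cc.
Proof. by have := chamber_strict CS (chamber0 CS) ltr01; rewrite scale1r addr0. Qed.

Lemma rdiag0 : rdiag pos (0 : 'E[R]_n) = 0 :> 'M[R]_(n, m).
Proof. by apply/matrixP => i k; rewrite !mxE mul0rn. Qed.

Lemma pair_conjK U V Y : G U V -> U^T *m (U *m Y *m V^T) *m V = Y.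
Proof.
move=> GUV; rewrite !mulmxA (mulmx1C (pair_orthl GG GUV)) mul1mx.
by rewrite -mulmxA (mulmx1C (pair_orthr GG GUV)) mulmx1.
Qed.

Lemma offdiag0_rdiag Y : (forall i k, k != pos i -> Y i k = 0) ->
  Y = rdiag pos (mdiag pos Y).
Proof.
move=> H; apply/matrixP => i k; rewrite !mxE.
by have [->//|/H->] := eqVneq k (pos i); rewrite mulr0n.
Qed.

(** A maximizer of [dot c] of the diagonal along the orbit of [Y] is diagonal and
    ordered. This provides the spectral decomposition of [Y] and, at the same
    time, the trace inequality for strictly ordered vectors. *)
Lemma spectral_maximum c Y : strict c -> space Y ->
  [/\ chamber (lam Y), exists U V, G U V /\ Y = U^T *m rdiag pos (lam Y) *m V &
    forall U V, G U V -> dot c (mdiag pos (U *m Y *m V^T)) <= dot c (lam Y)].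
Proof.
move=> cs sY.
have [|U [V [GUV _ Hmax]]] := @orbit_maximizer 0 0 c Y.
  exists 1%:M, 1%:M; split; first exact: pair_one.
  by rewrite rdiag0 mulmx0 mul0mx.
set Y1 : euc _ := U *m Y *m V^T in Hmax.
have sY1 : space Y1 by exact: (space_act CS).
have {}Hmax U' V' : G U' V' -> dot c (mdiag pos (U' *m Y *m V'^T)) <= dot c (mdiag pos Y1).
  by move=> G'; apply: Hmax => //; rewrite rdiag0 mulmx0 mul0mx.
have Hact J K : G J K -> dot c (mdiag pos (J *m Y1 *m K^T)) <= dot c (mdiag pos Y1).
  move=> GJK; have := Hmax _ _ (pair_mul GG GJK GUV).
  by rewrite trmx_mul !mulmxA.
have chY1 := chamber_max CS cs sY1 Hact.
have [C C0 HC] := offdiag_max CS cs (chamber0 CS).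
have Y1E : Y1 = rdiag pos (mdiag pos Y1).
  apply: offdiag0_rdiag => i k ki; apply/eqP; rewrite -sqrf_eq0.
  rewrite eq_le sqr_ge0 andbT.
  have := HC Y1 0 sY1 (lexx _) _ _ i k ki; rewrite !mulr0; apply.
    by move=> J K _; rewrite !dot0l addr0.
  by move=> J K GJK _; exact: Hact.
have YE : Y = U^T *m rdiag pos (mdiag pos Y1) *m V.
  by rewrite -Y1E pair_conjK.
have lamY : lam Y = mdiag pos Y1 by rewrite YE (lam_frame CS).
split; rewrite ?lamY//.
by exists U, V.
Qed.

Lemma chamber_lam Y : space Y -> chamber (lam Y).
Proof. by move=> sY; have [] := spectral_maximum strict_cc sY. Qed.

Lemma spectral_decomposition Y : space Y ->
  exists U V, G U V /\ Y = U^T *m rdiag pos (lam Y) *m V.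
Proof. by move=> sY; have [] := spectral_maximum strict_cc sY. Qed.

(** The trace inequality, by approximation of [x] by strictly ordered
    vectors. *)
Lemma mdiag_dot_le x U V Y : chamber x -> G U V -> space Y ->
  dot x (mdiag pos (U *m Y *m V^T)) <= dot x (lam Y).
Proof.
move=> chx GUV sY; rewrite -subr_le0.
apply: (@le0_of_le_small _ _ (dot cc (lam Y) - dot cc (mdiag pos (U *m Y *m V^T)))).
move=> t /andP[t0 _].
have [_ _ /(_ _ _ GUV)] := spectral_maximum (chamber_strict CS chx t0) sY.
by rewrite !dotDl !dotZl; lra.
Qed.

Lemma frame_dot x Y U V : dot (U^T *m rdiag pos x *m V : 'M[R]_(n, m)) Y =
  dot x (mdiag pos (U *m Y *m V^T)).
Proof. by rewrite dot_rect_adj rdiag_mdiag_dot. Qed.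

Lemma frame_dot_frame x y U V : G U V ->
  dot (U^T *m rdiag pos x *m V : 'M[R]_(n, m)) (U^T *m rdiag pos y *m V) = dot x y.
Proof.
move=> GUV; rewrite frame_dot !mulmxA (pair_orthl GG GUV) mul1mx.
by rewrite -mulmxA (pair_orthr GG GUV) mulmx1 rdiagK.
Qed.

Lemma dot_lam_le X Y : space X -> space Y -> dot X Y <= dot (lam X) (lam Y).
Proof.
move=> sX sY; have [U [V [GUV XE]]] := spectral_decomposition sX.
rewrite {1}XE frame_dot; apply: mdiag_dot_le => //; exact: chamber_lam.
Qed.

Lemma norm_lam_space X : space X -> `|lam X| = `|X|.
Proof.
move=> sX; have [U [V [GUV XE]]] := spectral_decomposition sX.
by rewrite !eucnormE [in RHS]XE frame_dot_frame.
Qed.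

Lemma norm_pair_act U V Y : G U V -> `|U *m Y *m V^T : euc 'M[R]_(n, m)| = `|Y|.
Proof.
move=> GUV; rewrite !eucnormE; congr Num.sqrt.
by rewrite -dot_rect_adj pair_conjK.
Qed.

Lemma norm_offdiag Y : `|Y - rdiag pos (mdiag pos Y)| ^+ 2 =
  \sum_i \sum_(k | k != pos i) Y i k ^+ 2.
Proof.
rewrite sqr_norm_dot mx_dotE; apply: eq_bigr => i _.
rewrite (bigD1 (pos i))//= !mxE eqxx mulr1n subrr mul0r add0r.
by apply: eq_bigr => k /negPf ki; rewrite !mxE ki mulr0n subr0 expr2.
Qed.

(** Among the frames of [X], the one maximizing a strictly ordered functional of
    the diagonal of [Y] has off-diagonal entries controlled by the gap in the
    trace inequality: rotating [X] itself cannot gain more than this gap. *)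
Lemma adapted_frame X (L : R) : space X -> exists C, forall Y, space Y -> `|Y| <= L ->
  exists U V, [/\ G U V, X = U^T *m rdiag pos (lam X) *m V &
    `|Y - U^T *m rdiag pos (mdiag pos (U *m Y *m V^T)) *m V| ^+ 2
      <= C * (dot (lam X) (lam Y) - dot X Y)].
Proof.
move=> sX; set v := lam X; have chv : chamber v := chamber_lam sX.
have [C0 C00 HC] := offdiag_max CS strict_cc chv.
exists ((n * m)%:R * (C0 * (6 * `|v| * L))) => Y sY YL.
have [U [V [GUV XE Hmax]]] := orbit_maximizer cc Y (spectral_decomposition sX).
exists U, V; split => //.
set Y1 : euc 'M[R]_(n, m) := U *m Y *m V^T.
have sY1 : space Y1 by exact: (space_act CS).
set D := _ - dot X Y.
have XY : dot X Y = dot v (mdiag pos Y1) by rewrite {1}XE frame_dot.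
have D0 : 0 <= D by rewrite subr_ge0 dot_lam_le.
have L0 : 0 <= L := le_trans (normr_ge0 _) YL.
have DvL : D <= 2 * `|v| * L.
  have h1 : dot v (lam Y) <= `|v| * L.
    by rewrite (le_trans (dot_le_norm _ _))// norm_lam_space// ler_wpM2l.
  have h2 : - dot X Y <= `|v| * L.
    rewrite -dotNr (le_trans (dot_le_norm _ _))// normrN /v norm_lam_space//.
    by rewrite ler_wpM2l.
  by rewrite /D; lra.
have off i k : k != pos i -> Y1 i k ^+ 2 <= C0 * (6 * `|v| * L) * D.
  move=> ki; have := HC Y1 D sY1 D0 _ _ i k ki => /(_ _ _)/le_trans; apply.
  - move=> J K GJK; rewrite -XY addrC subrK.
    have := mdiag_dot_le chv (pair_mul GG GJK GUV) sY.
    by rewrite trmx_mul !mulmxA.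
  - move=> J K GJK stab; have := Hmax _ _ (pair_mul GG GJK GUV).
    rewrite !trmx_mul !mulmxA; apply; rewrite {1}XE -[in LHS]stab.
    by rewrite !mulmxA.
  - rewrite -[leRHS]mulrA ler_wpM2l// ler_wpM2r//.
    rewrite norm_pair_act//; have : `|v| * `|Y| <= `|v| * L by rewrite ler_wpM2l.
    lra.
have -> : `|Y - U^T *m rdiag pos (mdiag pos Y1) *m V| = `|Y1 - rdiag pos (mdiag pos Y1)|.
  rewrite -(norm_pair_act _ GUV); congr `|_|.
  rewrite mulmxBr mulmxBl -/Y1 !mulmxA (pair_orthl GG GUV) mul1mx.
  by rewrite -(mulmxA _ V) (pair_orthr GG GUV) mulmx1.
rewrite norm_offdiag; apply: (@le_trans _ _
    (\sum_(i < n) \sum_(k < m) C0 * (6 * `|v| * L) * D)).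
  apply: ler_sum => i _; rewrite big_mkcond /=; apply: ler_sum => k _.
  case: ifP => [/off//|_]; rewrite mulr_ge0// mulr_ge0// !mulr_ge0//.
by rewrite !sumr_const !card_ord -mulrnA -[leLHS]mulr_natl [(m * n)%N]mulnC !mulrA.
Qed.

End orthogonal_pairs.

(** * Optimality conditions along plane rotations *)

(** When no rotation of the given kind gains more than [D], the derivative of the
    gain at the identity is controlled by [D] through [circle_gain]. *)
Section rotation_conditions.
Variables (R : realType) (n m : nat) (pos : 'I_n -> 'I_m).
Hypothesis pos_inj : injective pos.
Variables (u : 'E[R]_n) (Y : euc 'M[R]_(n, m)) (D : R).
Hypothesis D0 : 0 <= D.
Let E := (4 * `|u| * `|Y| + D) * D.

Let entry_prod i j k : `|u i 0 * Y j k| <= `|u| * `|Y|.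
Proof. by rewrite normrM ler_pM// entry_le_norm. Qed.

Let gain_bound (A B : R) : `|A| <= 2 * (`|u| * `|Y|) ->
  B ^+ 2 <= (2 * `|A| + D) * D -> B ^+ 2 <= E.
Proof.
move=> HA /le_trans; apply; rewrite ler_wpM2r// lerD2r -mulrA; lra.
Qed.

Lemma left_condition (i j : 'I_n) : i != j ->
    (forall c s, c ^+ 2 + s ^+ 2 = 1 ->
      dot u (mdiag pos (givens i j c s *m Y)) <= dot u (mdiag pos Y) + D) ->
  (u i 0 * Y j (pos i) - u j 0 * Y i (pos j)) ^+ 2 <= E.
Proof.
move=> ij H.
apply: (@gain_bound (u i 0 * Y i (pos i) + u j 0 * Y j (pos j))).
  rewrite (le_trans (ler_normD _ _))//.
  by rewrite mulr2n mulrDl mul1r lerD.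
apply: circle_gain => c s /H; rewrite -lerBlDl.
by rewrite gain_left.
Qed.

Lemma right_condition (i j : 'I_n) : i != j ->
    (forall c s, c ^+ 2 + s ^+ 2 = 1 ->
      dot u (mdiag pos (Y *m (givens (pos i) (pos j) c s)^T))
        <= dot u (mdiag pos Y) + D) ->
  (u i 0 * Y i (pos j) - u j 0 * Y j (pos i)) ^+ 2 <= E.
Proof.
move=> ij H.
apply: (@gain_bound (u i 0 * Y i (pos i) + u j 0 * Y j (pos j))).
  rewrite (le_trans (ler_normD _ _))//.
  by rewrite mulr2n mulrDl mul1r lerD.
apply: circle_gain => c s /H; rewrite -lerBlDl.
by rewrite gain_right.
Qed.

Lemma outside_condition (i : 'I_n) (k : 'I_m) : (forall j, k != pos j) ->
    (forall c s, c ^+ 2 + s ^+ 2 = 1 ->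
      dot u (mdiag pos (Y *m (givens (pos i) k c s)^T))
        <= dot u (mdiag pos Y) + D) ->
  (u i 0 * Y i k) ^+ 2 <= E.
Proof.
move=> kpos H; apply: (@gain_bound (u i 0 * Y i (pos i))).
  have := entry_prod i i (pos i); have := normr_ge0 (u i 0 * Y i (pos i)); lra.
apply: circle_gain => c s /H; rewrite -lerBlDl.
by rewrite gain_outside.
Qed.

Lemma both_condition (i j : 'I_n) : i != j ->
    (forall c s, c ^+ 2 + s ^+ 2 = 1 ->
      dot u (mdiag pos (givens i j c s *m Y *m (givens (pos i) (pos j) c s)^T))
        <= dot u (mdiag pos Y) + D) ->
  ((u i 0 - u j 0) * (Y i (pos j) + Y j (pos i)) / 2) ^+ 2 <= E.
Proof.
move=> ij H.
apply: (@gain_bound ((u i 0 - u j 0) * (Y i (pos i) - Y j (pos j)) / 2)).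
  rewrite normrM [`|2^-1|]ger0_norm ?invr_ge0// ler_pdivrMr//.
  rewrite mulrBl !mulrBr.
  have := entry_prod i i (pos i); have := entry_prod i j (pos j).
  have := entry_prod j i (pos i); have := entry_prod j j (pos j).
  rewrite !ler_norml; lra.
apply: circle_gain_double => c s cs; have := H _ _ cs; rewrite -lerBlDl.
by rewrite gain_both// => /(le_trans _); apply; rewrite le_eqVlt; apply/orP;
  left; apply/eqP; field.
Qed.

Lemma both_sorted (i j : 'I_n) : i != j ->
    (forall c s, c ^+ 2 + s ^+ 2 = 1 ->
      dot u (mdiag pos (givens i j c s *m Y *m (givens (pos i) (pos j) c s)^T))
        <= dot u (mdiag pos Y)) ->
  0 <= (u i 0 - u j 0) * (Y i (pos i) - Y j (pos j)).
Proof.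
move=> ij H; have cs : 0 ^+ 2 + 1 ^+ 2 = 1 :> R by rewrite expr0n expr1n add0r.
have := H _ _ cs; rewrite -subr_le0 gain_both// expr1n mul0r mulr0 addr0 mulr1.
by rewrite oppr_le0.
Qed.

End rotation_conditions.

Section rotation_stabilizers.
Variables (R : realType) (n m : nat) (pos : 'I_n -> 'I_m).
Hypothesis pos_inj : injective pos.
Variables (v : 'E[R]_n).

Lemma givens_tr p (i j : 'I_p) (c s : R) : i != j ->
  (givens i j c s)^T = givens i j c (- s).
Proof.
move=> ij; have ji : (j == i) = false by rewrite eq_sym (negPf ij).
apply/matrixP => k l; rewrite !mxE.
have [ki|ki] := eqVneq k i; have [li|li] := eqVneq l i; subst => //.
- by rewrite (negPf li).
- by rewrite (negPf ki) opprK.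
have [kj|kj] := eqVneq k j; have [lj|lj] := eqVneq l j => //.
- by rewrite kj (negPf lj).
- by rewrite lj (negPf kj).
- by rewrite eq_sym.
Qed.

Lemma left_stabilizer (i j : 'I_n) c s : i != j -> v i 0 = 0 -> v j 0 = 0 ->
  (givens i j c s)^T *m rdiag pos v = rdiag pos v.
Proof.
move=> ij vi vj; rewrite givens_tr//; apply/matrixP => k l.
rewrite givens_mulE// !mxE vi vj !mul0rn !mulr0 addr0.
have [->|ki] := eqVneq k i; first by rewrite vi mul0rn.
by have [->|kj] := eqVneq k j; first by rewrite vj mul0rn.
Qed.

Lemma right_stabilizer (a b : 'I_m) c s : a != b ->
    (forall k, pos k = a \/ pos k = b -> v k 0 = 0) ->
  rdiag pos v *m givens a b c s = rdiag pos v.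
Proof.
move=> ab H; rewrite -[givens _ _ _ _]trmxK givens_tr//; apply/matrixP => k l.
have H0 d : d = a \/ d = b -> v k 0 *+ (d == pos k) = 0.
  by have [dk|//] := eqVneq d (pos k); rewrite dk => /H->; rewrite mul0rn.
rewrite mul_givens_trE// !mxE.
rewrite (H0 a (or_introl erefl)) (H0 b (or_intror erefl)) !mulr0 addr0.
have [->|la] := eqVneq l a; first by rewrite H0//; left.
by have [->|lb] := eqVneq l b; first by rewrite H0//; right.
Qed.

Lemma both_stabilizer (i j : 'I_n) c s : i != j -> v i 0 = v j 0 ->
    c ^+ 2 + s ^+ 2 = 1 ->
  (givens i j c s)^T *m rdiag pos v *m givens (pos i) (pos j) c s = rdiag pos v.
Proof.
move=> ij vij cs; have pij : pos i != pos j by rewrite (inj_eq pos_inj).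
have pji : (pos j == pos i) = false by rewrite eq_sym (negPf pij).
have cs' : c * c + s * s = 1 by rewrite -!expr2.
rewrite givens_tr// -[givens (pos i) _ _ _]trmxK givens_tr//.
apply/matrixP => k l.
rewrite mul_givens_trE// !givens_mulE// !mxE !eqxx pji (negPf pij) vij.
rewrite !mulr1n !mulr0n !mulr0 !addr0 !add0r.
have [ki|ki] := eqVneq k i; first subst k.
  rewrite vij; have [li|li] := eqVneq l (pos i); first subst l.
    by rewrite !mulr1n -[RHS]mul1r -cs'; ring.
  by have [lj|lj] := eqVneq l (pos j); rewrite !mulr0n; ring.
have [kj|kj] := eqVneq k j; first subst k.
  have [li|li] := eqVneq l (pos i); first subst l.
    by rewrite ?(negPf pij) ?mulr1n ?mulr0n; ring.
  have [lj|lj] := eqVneq l (pos j); first subst l.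
    by rewrite ?mulr1n -[RHS]mul1r -cs'; ring.
  by rewrite !mulr0n; ring.
have pik : (pos i == pos k) = false by rewrite (inj_eq pos_inj) eq_sym (negPf ki).
have pjk : (pos j == pos k) = false by rewrite (inj_eq pos_inj) eq_sym (negPf kj).
have [li|li] := eqVneq l (pos i); first subst l.
  by rewrite pik pjk !mulr0n !mulr0 addr0.
have [lj|//] := eqVneq l (pos j); subst l.
by rewrite pik pjk !mulr0n !mulr0 addr0.
Qed.

End rotation_stabilizers.

(** * Eigenvalues and singular values of a frame *)

Section eigenvalues.
Variables (R : realType) (n : nat).
Implicit Types (A U : 'M[R]_n) (x : 'E[R]_n).

Definition ordered x := forall i j : 'I_n, (i <= j)%N -> x j 0 <= x i 0.

Lemma char_poly_orth_conj U A : U *m U^T = 1%:M ->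
  char_poly (U^T *m A *m U) = char_poly A.
Proof.
move=> UU; have UU' := mulmx1C UU.
rewrite /char_poly /char_poly_mx.
have -> : 'X%:M - map_mx polyC (U^T *m A *m U) =
    map_mx polyC U^T *m ('X%:M - map_mx polyC A) *m map_mx polyC U.
  rewrite mulmxBr mulmxBl -!map_mxM scalar_mxC -(mulmxA 'X%:M) -map_mxM UU'.
  by rewrite map_mx1 mulmx1.
by rewrite !det_mulmx mulrAC -det_mulmx -map_mxM UU' map_mx1 det1 mul1r.
Qed.

Lemma char_poly_rdiag x :
  char_poly (rdiag id x : 'M[R]_n) = \prod_i ('X - (x i 0)%:P).
Proof.
rewrite char_poly_trig.
  by apply: eq_bigr => i _; rewrite mxE eqxx mulr1n.
apply/is_trig_mxP => i j ij; rewrite mxE.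
by have [ji|_] := eqVneq j i; [move: ij; rewrite ji ltnn|rewrite mulr0n].
Qed.

(** The roots of a split polynomial are determined up to order. *)
Lemma eigenvalues_perm A x : A^T = A ->
    char_poly A = \prod_i ('X - (x i 0)%:P) ->
  exists s : 'S_n, eigenvalues A = perm_mx s *m x.
Proof.
move=> /eigenvaluesP[charE _]; rewrite charE.
set l := eigenvalues A => E.
pose tl := [tuple l i 0 | i < n]; pose tx := [tuple x i 0 | i < n].
have /tuple_permP[s sE] : perm_eq tl tx.
  apply: prod_XsubC_eq; rewrite !big_map -!enumT !big_enum /=.
  exact: E.
exists s; apply/colP => i; rewrite -row_permE mxE.
have := congr1 (fun t => nth 0 t i) sE.
by rewrite -!tnth_nth !tnth_mktuple.
Qed.

Lemma ordered_perm_eq x y (s : 'S_n) : ordered x -> ordered y ->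
  y = perm_mx s *m x -> y = x.
Proof.
move=> ox oy yE.
pose tx := [tuple x i 0 | i < n]; pose ty := [tuple y i 0 | i < n].
have sorted_t (z : 'E[R]_n) : ordered z -> sorted >=%O [tuple z i 0 | i < n].
  move=> oz; apply/(sortedP 0) => k; rewrite size_tuple => kn.
  have kn' : (k < n)%N := ltnW kn.
  rewrite -[k.+1]/(val (Ordinal kn)) -[k in nth _ _ k]/(val (Ordinal kn')).
  rewrite -!tnth_nth !tnth_mktuple; exact: (oz (Ordinal kn') (Ordinal kn) (leqnSn k)).
have txy : tval ty = tval tx.
  apply: (@sorted_eq _ >=%O); [|by move=> a b /le_anti|exact: sorted_t|exact: sorted_t|].
    by move=> a b c ba cb; apply: le_trans cb ba.
  apply/tuple_permP; exists s; congr tval; apply: eq_from_tnth => i.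
  by rewrite !tnth_mktuple yE -row_permE mxE.
apply/colP => i; have := congr1 (fun t => nth 0 t i) txy.
by rewrite -!tnth_nth !tnth_mktuple.
Qed.

Lemma eigenvalues_ordered A x : A^T = A -> ordered x ->
  char_poly A = \prod_i ('X - (x i 0)%:P) -> eigenvalues A = x.
Proof.
move=> Asym ox charE; have [s sE] := eigenvalues_perm Asym charE.
apply: ordered_perm_eq sE => //; exact: (eigenvaluesP Asym).2.
Qed.

Lemma eigenvalues_char_poly A B : char_poly A = char_poly B ->
  eigenvalues A = eigenvalues B :> 'E[R]_n.
Proof. by rewrite /eigenvalues /is_eigenvalue_vector => ->. Qed.

Lemma orth_conj_sym U A : A^T = A -> (U^T *m A *m U)^T = U^T *m A *m U.
Proof. by move=> As; rewrite !trmx_mul trmxK As mulmxA. Qed.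

Lemma rdiag_sym x : (rdiag id x : 'M[R]_n)^T = rdiag id x.
Proof.
by apply/matrixP => i j; rewrite !mxE; have [->|] := eqVneq i j.
Qed.

End eigenvalues.

Section singular_values.
Variables (R : realType) (n m : nat) (pos : 'I_n -> 'I_m).
Hypothesis pos_inj : injective pos.
Implicit Types (U : 'M[R]_n) (V : 'M[R]_m) (x : 'E[R]_n).

Definition sqr_vec x : 'E[R]_n := map_mx (fun a => a ^+ 2) x.

Lemma gram_rdiag U V x : V *m V^T = 1%:M ->
  (U^T *m rdiag pos x *m V) *m (U^T *m rdiag pos x *m V)^T =
    U^T *m rdiag id (sqr_vec x) *m U.
Proof.
move=> VV; rewrite !trmx_mul trmxK !mulmxA -(mulmxA _ V) VV mulmx1.
congr (_ *m _); rewrite -mulmxA; congr (_ *m _).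
apply/matrixP => i j; rewrite mxE (bigD1 (pos i))//= big1 ?addr0.
  rewrite !mxE eqxx mulr1n (inj_eq pos_inj).
  by have [->|ij] := eqVneq i j; rewrite ?mulr1n ?expr2 // !mulr0n mulr0.
by move=> k /negPf ki; rewrite !mxE ki mulr0n mul0r.
Qed.

Lemma singular_values_perm U V x : U *m U^T = 1%:M -> V *m V^T = 1%:M ->
  exists s : 'S_n, singular_values (U^T *m rdiag pos x *m V) =
    map_mx Num.norm (perm_mx s *m x).
Proof.
move=> UU VV; rewrite /singular_values gram_rdiag//.
have [||s ->] := @eigenvalues_perm R n (U^T *m rdiag id (sqr_vec x) *m U) (sqr_vec x).
- by apply: orth_conj_sym; exact: rdiag_sym.
- by rewrite char_poly_orth_conj// char_poly_rdiag.
exists s; apply/colP => i; rewrite -!row_permE !mxE sqrtr_sqr.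
by [].
Qed.

Lemma singular_values_ordered U V x : U *m U^T = 1%:M -> V *m V^T = 1%:M ->
    ordered x -> (forall i, 0 <= x i 0) ->
  singular_values (U^T *m rdiag pos x *m V) = x.
Proof.
move=> UU VV ox x0; rewrite /singular_values gram_rdiag//.
rewrite (@eigenvalues_ordered R n _ (sqr_vec x)).
- by apply/colP => i; rewrite !mxE sqrtr_sqr ger0_norm.
- by apply: orth_conj_sym; exact: rdiag_sym.
- by move=> i j ij; rewrite !mxE lerXn2r ?nnegrE// ox.
- by rewrite char_poly_orth_conj// char_poly_rdiag.
Qed.

Lemma singular_values_frame U V U' V' x : U *m U^T = 1%:M -> V *m V^T = 1%:M ->
  U' *m U'^T = 1%:M -> V' *m V'^T = 1%:M ->
  singular_values (U^T *m rdiag pos x *m V) =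
  singular_values (U'^T *m rdiag pos x *m V').
Proof.
move=> UU VV UU' VV'; rewrite /singular_values (gram_rdiag U x VV) (gram_rdiag U' x VV').
congr map_mx; apply: eigenvalues_char_poly.
by rewrite !char_poly_orth_conj.
Qed.

End singular_values.

(** * The chambers of ordered vectors *)

Section chambers.
Variables (R : realType) (n : nat).
Implicit Types (x y : 'E[R]_n).

Definition strictly_ordered x := forall i j : 'I_n, (i < j)%N -> x j 0 < x i 0.

Definition countdown : 'E[R]_n := \col_i (n - i)%:R.

Lemma countdown_gt0 i : 0 < countdown i 0.
Proof. by rewrite mxE ltr0n subn_gt0. Qed.

Lemma countdown_strict x (eps : R) : ordered x -> 0 < eps ->
  strictly_ordered (eps *: countdown + x).
Proof.
move=> ox eps0 i j ij; rewrite !mxE ltr_leD//; last exact/ox/ltnW.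
by rewrite ltr_pM2l// ltr_nat ltn_sub2l.
Qed.

Lemma strictly_ordered_neq x i j : strictly_ordered x -> i != j ->
  x i 0 - x j 0 != 0.
Proof.
move=> sx; rewrite subr_eq0 neq_ltn => /orP[|] /sx; first by move/gt_eqF => ->.
by move/lt_eqF => ->.
Qed.

(** The hypothesis is the second-order condition given by [both_sorted]. *)
Lemma ordered_of_products x y : strictly_ordered x ->
    (forall i j, i != j -> 0 <= (x i 0 - x j 0) * (y i 0 - y j 0)) ->
  ordered y.
Proof.
move=> sx H i j; rewrite leq_eqVlt => /orP[/eqP/val_inj->//|ij].
have := H i j; rewrite -val_eqE ltn_eqF//= => /(_ isT).
have xij : 0 < x i 0 - x j 0 by rewrite subr_gt0 sx.
by rewrite pmulr_rge0// subr_ge0.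
Qed.

End chambers.

Section orthogonal_matrices.
Variable R : realType.

Lemma pair_fst_continuous p q :
  entrywise_continuous (fun w : euc 'M[R]_p * euc 'M[R]_q => w.1 : 'M[R]_p).
Proof.
move=> i j w; apply: (@continuous_comp _ _ _ fst (fun U : euc 'M[R]_p => U i j)).
  exact: cvg_fst.
exact: entry_continuous.
Qed.

Lemma pair_snd_continuous p q :
  entrywise_continuous (fun w : euc 'M[R]_p * euc 'M[R]_q => w.2 : 'M[R]_q).
Proof.
move=> i j w; apply: (@continuous_comp _ _ _ snd (fun U : euc 'M[R]_q => U i j)).
  exact: cvg_snd.
exact: entry_continuous.
Qed.

Lemma orth_mul p (J J' : 'M[R]_p) : J *m J^T = 1%:M -> J' *m J'^T = 1%:M ->
  (J *m J') *m (J *m J')^T = 1%:M.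
Proof. by move=> JJ JJ'; rewrite trmx_mul mulmxA -(mulmxA J) JJ' mulmx1. Qed.

Lemma orth1 p : (1%:M : 'M[R]_p) *m 1%:M^T = 1%:M.
Proof. by rewrite trmx1 mulmx1. Qed.

End orthogonal_matrices.

Section symmetric_chamber.
Variables (R : realType) (n : nat).

Definition same_orth (J K : 'M[R]_n) := J = K /\ J *m J^T = 1%:M.

Lemma same_orth_group : orthogonal_pair_group same_orth.
Proof.
split.
- by move=> J K [].
- by move=> J K [<-].
- by split; rewrite // trmx1 mulmx1.
- by move=> J K J' K' [<- JJ] [<- JJ']; split => //; exact: orth_mul.
pose T := (euc 'M[R]_n * euc 'M[R]_n)%type.
rewrite (_ : mkset _ = [set w : T | (w.1 : 'M[R]_n) - (w.2 : 'M[R]_n) = 0] `&`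
    [set w : T | (w.1 : 'M[R]_n) *m (w.1 : 'M[R]_n)^T = 1%:M]); last first.
  apply/seteqP; split=> [[U V]/= [-> VV]|[U V]/= [/eqP]].
    by rewrite subrr.
  by rewrite subr_eq0 => /eqP-> VV; split.
apply: closedI.
  apply: (@entrywise_closed_eq _ T _ _ 0 (fun w : T => (w.1 : 'M[R]_n) - (w.2 : 'M[R]_n))).
  move=> i j; rewrite (_ : (fun _ => _) =
      (fun w : T => (w.1 : 'M[R]_n) i j) - (fun w : T => (w.2 : 'M[R]_n) i j)).
    by move=> w; apply: (@continuousB _ R^o); [exact: pair_fst_continuous|exact: pair_snd_continuous].
  by apply/funext => w; rewrite !mxE.
apply: (@entrywise_closed_eq _ T _ _ 1%:M (fun w : T => (w.1 : 'M[R]_n) *m (w.1 : 'M[R]_n)^T)).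
apply: entrywise_mul; first exact: pair_fst_continuous.
by apply: entrywise_tr; exact: pair_fst_continuous.
Qed.

Lemma givens_same_orth (i j : 'I_n) c s : i != j -> c ^+ 2 + s ^+ 2 = 1 ->
  same_orth (givens i j c s) (givens i j c s).
Proof. by move=> ij cs; split => //; exact: givens_orth. Qed.

(** Off the diagonal, a rotation in the plane of [i] and [j] has the derivative
    [2 * (v i 0 - v j 0) * Y i j] for [v]; when [v i 0 = v j 0] the rotation
    stabilizes [v], and the corresponding derivative for [c] must be zero. *)
Lemma symmetric_chamber_system :
  chamber_system id same_orth (@ordered R n) (@strictly_ordered R n)
    [set Y : euc 'M[R]_n | (Y : 'M[R]_n)^T = Y] (@eigenvalues R n) (countdown R n).
Proof.
split.
- by move=> i j _; rewrite !mxE.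
- by move=> x eps ox eps0; exact: countdown_strict.
- by move=> J K Y [<- _] /= Ys; rewrite !trmx_mul trmxK Ys mulmxA.
- move=> U V x [<- UU] ox; apply: eigenvalues_ordered => //.
    by apply: orth_conj_sym; exact: rdiag_sym.
  by rewrite char_poly_orth_conj// char_poly_rdiag.
- move=> c Y sc _ H; apply: (ordered_of_products sc) => i j ij.
  rewrite !mdiagE; apply: both_sorted => // a b ab.
  by apply: H; exact: givens_same_orth.
move=> c v sc ov.
suff [C C0 HC] : exists2 C : R, 0 <= C & forall ij : 'I_n * 'I_n,
    ij.2 != ij.1 -> forall (Y : euc 'M[R]_n) (D : R), (Y : 'M[R]_n)^T = Y -> 0 <= D ->
    (forall J K, same_orth J K ->
      dot v (mdiag id (J *m Y *m K^T)) <= dot v (mdiag id Y) + D) ->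
    (forall J K, same_orth J K -> J^T *m rdiag id v *m K = rdiag id v ->
      dot c (mdiag id (J *m Y *m K^T)) <= dot c (mdiag id Y)) ->
    Y ij.1 ij.2 ^+ 2 <= C * ((4 * `|v| * `|Y| + D) * D).
  by exists C => // Y D Ys D0 Hv Hc i k ki; exact: (HC (i, k)).
apply: finite_upper_bound => -[i j] /=.
exists ((v i 0 - v j 0) ^- 2) => [|C HC]; first by rewrite invr_ge0 sqr_ge0.
rewrite eq_sym => ij Y D Ys D0 Hv Hc.
have Yji : Y j i = Y i j by rewrite -[in LHS]Ys mxE.
have E0 : 0 <= (4 * `|v| * `|Y : euc 'M[R]_n| + D) * D by rewrite mulr_ge0// addr_ge0// !mulr_ge0.
have [vij|vij] := eqVneq (v i 0) (v j 0).
  have -> : Y i j = 0.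
    have H a b : a ^+ 2 + b ^+ 2 = 1 ->
        dot c (mdiag id (givens i j a b *m Y *m (givens i j a b)^T)) <= dot c (mdiag id Y) + 0.
      move=> ab; rewrite addr0; apply: Hc; first exact: givens_same_orth.
      exact: (@both_stabilizer _ _ _ id).
    have := both_condition (@inj_id _) (lexx _) ij H; rewrite mulr0.
    rewrite Yji => h; have : (c i 0 - c j 0) * (Y i j + Y i j) / 2 = 0.
      by apply/eqP; rewrite -sqrf_eq0 eq_le sqr_ge0 andbT.
    move=> /eqP; rewrite -mulrA mulf_eq0 (negPf (strictly_ordered_neq sc ij)) /=.
    by move=> /eqP; lra.
  rewrite expr0n /=; apply: mulr_ge0 => //; apply: le_trans HC.
  by rewrite invr_ge0 sqr_ge0.
have := @both_condition _ _ _ id (@inj_id _) v Y D D0 i j ij.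
move=> /(_ (fun a b ab => Hv _ _ (givens_same_orth ij ab))).
rewrite Yji (_ : _ / 2 = (v i 0 - v j 0) * Y i j); last by field.
rewrite exprMn => H; apply: le_trans (ler_wpM2r E0 HC).
by rewrite ler_pdivlMl// exprn_even_gt0//= subr_eq0.
Qed.

End symmetric_chamber.

Section rectangular_chamber.
Variables (R : realType) (n m : nat) (pos : 'I_n -> 'I_m).
Hypothesis pos_inj : injective pos.

Definition orth_pair (J : 'M[R]_n) (K : 'M[R]_m) :=
  J *m J^T = 1%:M /\ K *m K^T = 1%:M.

Lemma orth_pair_group : orthogonal_pair_group orth_pair.
Proof.
split.
- by move=> J K [].
- by move=> J K [].
- by split; rewrite trmx1 mulmx1.
- by move=> J K J' K' [JJ KK] [JJ' KK']; split; exact: orth_mul.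
pose T := (euc 'M[R]_n * euc 'M[R]_m)%type.
apply: (@closedI _ [set w : T | (w.1 : 'M[R]_n) *m (w.1 : 'M[R]_n)^T = 1%:M]
    [set w : T | (w.2 : 'M[R]_m) *m (w.2 : 'M[R]_m)^T = 1%:M]).
  apply: (@entrywise_closed_eq _ T _ _ 1%:M (fun w : T => (w.1 : 'M[R]_n) *m (w.1 : 'M[R]_n)^T)).
  apply: entrywise_mul; first exact: pair_fst_continuous.
  by apply: entrywise_tr; exact: pair_fst_continuous.
apply: (@entrywise_closed_eq _ T _ _ 1%:M (fun w : T => (w.2 : 'M[R]_m) *m (w.2 : 'M[R]_m)^T)).
apply: entrywise_mul; first exact: pair_snd_continuous.
by apply: entrywise_tr; exact: pair_snd_continuous.
Qed.

Let nonneg_ordered : set 'E[R]_n := [set x | ordered x /\ forall i, 0 <= x i 0].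
Let pos_ordered : set 'E[R]_n :=
  [set x | strictly_ordered x /\ forall i, 0 < x i 0].

(** Three cases for an entry [(i, k)] off the diagonal. When [k] is outside the
    range of [pos], one rotation of the columns controls it. When [k = pos j] and
    [v i 0 != v j 0], rotations of the rows and of the columns control two
    independent combinations of the entries [(i, pos j)] and [(j, pos i)]. When
    [v i 0 = v j 0 != 0] they only control the difference of these entries, and
    the sum vanishes because the simultaneous rotation stabilizes [v]; when both
    are zero, rows and columns rotate independently in the stabilizer. *)
Section entry_bound.
Variables (c v : 'E[R]_n) (i : 'I_n) (k : 'I_m).
Hypothesis cs : pos_ordered c.
Hypothesis vs : nonneg_ordered v.
Hypothesis ki : k != pos i.

Definition rect_entry_bound (C : R) := forall (Y : euc 'M[R]_(n, m)) (D : R), 0 <= D ->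
    (forall J K, orth_pair J K ->
      dot v (mdiag pos (J *m Y *m K^T)) <= dot v (mdiag pos Y) + D) ->
    (forall J K, orth_pair J K -> J^T *m rdiag pos v *m K = rdiag pos v ->
      dot c (mdiag pos (J *m Y *m K^T)) <= dot c (mdiag pos Y)) ->
    Y i k ^+ 2 <= C * ((4 * `|v| * `|Y| + D) * D).

Lemma rect_entry_bound_outside : (forall j, k != pos j) ->
  rect_entry_bound (v i 0 ^- 2).
Proof.
move=> kpos Y D D0 Hv Hc; have ik : pos i != k by rewrite eq_sym.
have GK a b : a ^+ 2 + b ^+ 2 = 1 -> orth_pair 1%:M (givens (pos i) k a b).
  by move=> ab; split; [exact: orth1|exact: givens_orth].
have [vi|vi] := eqVneq (v i 0) 0.
  have H a b : a ^+ 2 + b ^+ 2 = 1 ->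
      dot c (mdiag pos (Y *m (givens (pos i) k a b)^T)) <= dot c (mdiag pos Y) + 0.
    move=> ab; rewrite addr0 -[X in X *m _](mul1mx (Y : 'M[R]_(n, m))).
    apply: Hc; first exact: GK.
    rewrite trmx1 mul1mx; apply: right_stabilizer => // j [/pos_inj->//|jk].
    by have := kpos j; rewrite jk eqxx.
  have := outside_condition pos_inj (lexx _) kpos H; rewrite mulr0 => h.
  have /eqP : c i 0 * Y i k = 0.
    by apply/eqP; rewrite -sqrf_eq0 eq_le sqr_ge0 andbT.
  rewrite mulf_eq0 (gt_eqF (cs.2 i)) /= => /eqP->.
  by rewrite expr0n /= !mulr_ge0 ?addr_ge0 ?mulr_ge0// invr_ge0 sqr_ge0.
have H a b : a ^+ 2 + b ^+ 2 = 1 ->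
    dot v (mdiag pos (Y *m (givens (pos i) k a b)^T)) <= dot v (mdiag pos Y) + D.
  move=> ab; rewrite -[X in X *m _](mul1mx (Y : 'M[R]_(n, m))).
  by apply: Hv; exact: GK.
have := outside_condition pos_inj D0 kpos H; rewrite exprMn => h.
by rewrite ler_pdivlMl// exprn_even_gt0.
Qed.

Variable j : 'I_n.
Hypothesis kj : k = pos j.

Lemma rect_entry_bound_diff : v i 0 != v j 0 ->
  rect_entry_bound (2 * (v i 0 ^+ 2 + v j 0 ^+ 2) / (v i 0 ^+ 2 - v j 0 ^+ 2) ^+ 2).
Proof.
move=> vij Y D D0 Hv Hc; have ij : i != j.
  by apply: contraNneq ki => ->; rewrite kj.
have pij : pos i != pos j by rewrite (inj_eq pos_inj).
have v2 : v i 0 ^+ 2 - v j 0 ^+ 2 != 0.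
  by rewrite subr_eq0 eqrXn2// ?(vs.2).
have HL a b : a ^+ 2 + b ^+ 2 = 1 ->
    dot v (mdiag pos (givens i j a b *m Y)) <= dot v (mdiag pos Y) + D.
  move=> ab; rewrite -[givens _ _ _ _ *m Y]mulmx1 -[X in _ *m X]trmx1.
  by apply: Hv; split; [exact: givens_orth|exact: orth1].
have HR a b : a ^+ 2 + b ^+ 2 = 1 ->
    dot v (mdiag pos (Y *m (givens (pos i) (pos j) a b)^T)) <= dot v (mdiag pos Y) + D.
  move=> ab; rewrite -[X in X *m _](mul1mx (Y : 'M[R]_(n, m))).
  by apply: Hv; split; [exact: orth1|exact: givens_orth].
have := sqr_sum_bound (v i 0) (v j 0) (right_condition pos_inj D0 ij HR) (left_condition D0 ij HL).
rewrite (_ : _ + _ = (v i 0 ^+ 2 - v j 0 ^+ 2) * Y i (pos j)); last by ring.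
rewrite exprMn -kj mulrC => h.
by rewrite [leRHS]mulrAC ler_pdivlMr ?exprn_even_gt0.
Qed.

Lemma rect_entry_bound_same : v i 0 = v j 0 ->
  rect_entry_bound ((2 * v i 0) ^- 2).
Proof.
move=> vij Y D D0 Hv Hc; have ij : i != j.
  by apply: contraNneq ki => ->; rewrite kj.
have pij : pos i != pos j by rewrite (inj_eq pos_inj).
have E0 : 0 <= (4 * `|v| * `|Y| + D) * D by rewrite mulr_ge0// addr_ge0// !mulr_ge0.
have [vi|vi] := eqVneq (v i 0) 0.
  have vj : v j 0 = 0 by rewrite -vij.
  have HL a b : a ^+ 2 + b ^+ 2 = 1 ->
      dot c (mdiag pos (givens i j a b *m Y)) <= dot c (mdiag pos Y) + 0.
    move=> ab; rewrite addr0 -[givens _ _ _ _ *m Y]mulmx1 -[X in _ *m X]trmx1.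
    apply: Hc; first by split; [exact: givens_orth|exact: orth1].
    by rewrite mulmx1 left_stabilizer.
  have HR a b : a ^+ 2 + b ^+ 2 = 1 ->
      dot c (mdiag pos (Y *m (givens (pos i) (pos j) a b)^T)) <= dot c (mdiag pos Y) + 0.
    move=> ab; rewrite addr0 -[X in X *m _](mul1mx (Y : 'M[R]_(n, m))).
    apply: Hc; first by split; [exact: orth1|exact: givens_orth].
    rewrite trmx1 mul1mx; apply: right_stabilizer => // l [/pos_inj->//|/pos_inj->//].
  have := sqr_sum_bound (c i 0) (c j 0) (right_condition pos_inj (lexx _) ij HR)
    (left_condition (lexx _) ij HL).
  rewrite !mulr0 (_ : _ + _ = (c i 0 ^+ 2 - c j 0 ^+ 2) * Y i (pos j)); last by ring.
  move=> h; have /eqP : (c i 0 ^+ 2 - c j 0 ^+ 2) * Y i (pos j) = 0.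
    by apply/eqP; rewrite -sqrf_eq0 eq_le sqr_ge0 andbT.
  have c2 : c i 0 ^+ 2 - c j 0 ^+ 2 != 0.
    rewrite subr_eq0 eqrXn2 ?(ltW (cs.2 _))// -subr_eq0.
    exact: strictly_ordered_neq cs.1 ij.
  rewrite mulf_eq0 (negPf c2) /= kj => /eqP->.
  by rewrite expr0n /= mulr_ge0// invr_ge0 sqr_ge0.
have HL a b : a ^+ 2 + b ^+ 2 = 1 ->
    dot v (mdiag pos (givens i j a b *m Y)) <= dot v (mdiag pos Y) + D.
  move=> ab; rewrite -[givens _ _ _ _ *m Y]mulmx1 -[X in _ *m X]trmx1.
  by apply: Hv; split; [exact: givens_orth|exact: orth1].
have HB a b : a ^+ 2 + b ^+ 2 = 1 ->
    dot c (mdiag pos (givens i j a b *m Y *m (givens (pos i) (pos j) a b)^T))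
      <= dot c (mdiag pos Y) + 0.
  move=> ab; rewrite addr0; apply: Hc; last exact: both_stabilizer.
  by split; exact: givens_orth.
have := both_condition pos_inj (lexx _) ij HB; rewrite mulr0 => h.
have /eqP : (c i 0 - c j 0) * (Y i (pos j) + Y j (pos i)) / 2 = 0.
  by apply/eqP; rewrite -sqrf_eq0 eq_le sqr_ge0 andbT.
rewrite -mulrA mulf_eq0 (negPf (strictly_ordered_neq cs.1 ij)) /= => /eqP h0.
have YY : Y j (pos i) = - Y i (pos j) by lra.
have := left_condition D0 ij HL; rewrite -vij YY.
rewrite (_ : _ - _ = - ((2 * v i 0) * Y i (pos j))); last by ring.
rewrite sqrrN exprMn kj => {}h.
by rewrite ler_pdivlMl// exprn_even_gt0//= mulf_neq0// pnatr_eq0.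
Qed.

End entry_bound.

Lemma rectangular_chamber_system :
  chamber_system pos orth_pair nonneg_ordered pos_ordered
    [set: euc 'M[R]_(n, m)] (@singular_values R n m) (countdown R n).
Proof.
split.
- by split=> [i j _|i]; rewrite !mxE.
- move=> x eps [ox x0] eps0; split; first exact: countdown_strict.
  by move=> i; rewrite 2!mxE ltr_wpDr// mulr_gt0// countdown_gt0.
- by [].
- by move=> U V x [UU VV] [ox x0]; exact: singular_values_ordered.
- move=> c Y [sc c0] _ H; split.
    apply: (ordered_of_products sc) => i j ij; rewrite !mdiagE.
    apply: both_sorted => // a b ab; apply: H.
    by split; apply: givens_orth => //; rewrite (inj_eq pos_inj).
  move=> i; have GF : orth_pair (flip R i) 1%:M.
    by split; [exact: flip_orth|exact: orth1].
  have := H _ _ GF; rewrite trmx1 mulmx1 !vdotE -subr_le0 -sumrB.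
  rewrite (bigD1 i)//= !mdiagE flip_mulE eqxx expr1 big1 => [|l li].
    by rewrite addr0 mulN1r mulrN -opprD oppr_le0 -mulrDr pmulr_rge0 ?c0//; lra.
  by rewrite !mdiagE flip_mulE (negPf li) expr0 mul1r subrr.
move=> c v sc ov.
suff [C C0 HC] : exists2 C : R, 0 <= C & forall ij : 'I_n * 'I_m,
    ij.2 != pos ij.1 -> rect_entry_bound c v ij.1 ij.2 C.
  by exists C => // Y D _ D0 Hv Hc i k ki; exact: (HC (i, k)).
apply: finite_upper_bound => -[i k] /=.
have mono (C0 : R) : 0 <= C0 -> (k != pos i -> rect_entry_bound c v i k C0) ->
    exists2 C, 0 <= C & forall C', C <= C' -> k != pos i -> rect_entry_bound c v i k C'.
  move=> C00 H; exists C0 => // C' C0C' ki Y D D0 Hv Hc.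
  apply: le_trans (H ki Y D D0 Hv Hc) _; rewrite ler_wpM2r//.
  by rewrite mulr_ge0// addr_ge0// !mulr_ge0.
have [[j kj]|/forallNP kpos] := pselect (exists j, k = pos j).
  have [vij|vij] := eqVneq (v i 0) (v j 0).
    apply: (mono ((2 * v i 0) ^- 2)); first by rewrite invr_ge0 sqr_ge0.
    by move=> ki; apply: rect_entry_bound_same kj vij.
  apply: (mono (2 * (v i 0 ^+ 2 + v j 0 ^+ 2) / (v i 0 ^+ 2 - v j 0 ^+ 2) ^+ 2)).
    by rewrite divr_ge0 ?sqr_ge0// mulr_ge0// addr_ge0 ?sqr_ge0.
  by move=> ki; apply: rect_entry_bound_diff kj vij.
apply: (mono (v i 0 ^- 2)); first by rewrite invr_ge0 sqr_ge0.
move=> ki; apply: rect_entry_bound_outside => // j.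
by apply/eqP; exact: kpos.
Qed.

End rectangular_chamber.

(** * The spectral systems of matrix spaces *)

Section signed_permutations.
Variables (R : realType) (n : nat).

Definition signed_perm_mx (p : 'S_n * {ffun 'I_n -> bool}) : 'M[R]_n :=
  diag_mx (\row_i (-1) ^+ p.2 i) *m perm_mx p.1.

Lemma perm_mx_orth (s : 'S_n) : (perm_mx s : 'M[R]_n) *m (perm_mx s)^T = 1%:M.
Proof. by rewrite tr_perm_mx -perm_mxM mulgV perm_mx1. Qed.

Lemma signed_perm_mx_orth p : signed_perm_mx p *m (signed_perm_mx p)^T = 1%:M.
Proof.
rewrite trmx_mul mulmxA -(mulmxA _ (perm_mx _)) perm_mx_orth mulmx1.
rewrite tr_diag_mx mulmx_diag -diag_const_mx; congr diag_mx.
by apply/rowP => i; rewrite !mxE -expr2 sqrr_sign.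
Qed.

Lemma norm_perm_signed (x : 'E[R]_n) (s : 'S_n) :
  exists p, map_mx Num.norm (perm_mx s *m x) = signed_perm_mx p *m x.
Proof.
exists (s, [ffun i => x (s i) 0 < 0]); apply/colP => i.
rewrite /signed_perm_mx -mulmxA -row_permE !mxE (bigD1 i)//= big1.
  rewrite !mxE eqxx mulr1n addr0 ffunE.
  case: ltP => x0; first by rewrite ltr0_norm// expr1 mulN1r.
  by rewrite ger0_norm// expr0 mul1r.
by move=> j /negPf ji; rewrite !mxE eq_sym ji mulr0n mul0r.
Qed.

End signed_permutations.

Section singular_value_system.
Variables (R : realType) (n m : nat) (le_nm : (n <= m)%N).
Let pos := widen_ord le_nm.

Let pos_inj : injective pos.
Proof. by move=> i j /(congr1 val)/= /val_inj. Qed.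

Let CS := @rectangular_chamber_system R n m pos pos_inj.
Let GG := @orth_pair_group R n m.

Lemma singular_trace (X Y : euc 'M[R]_(n, m)) :
  dot X Y <= dot (singular_values X) (singular_values Y).
Proof. exact: (dot_lam_le GG CS (X := X) (Y := Y) I I). Qed.

Lemma singular_spectral_system : spectral_system (@singular_values R n m)
  (@signed_perm_mx R n).
Proof.
split.
- exact: signed_perm_mx_orth.
- exact: singular_trace.
move=> X L; have [C HC] := adapted_frame GG CS L (I : [set: euc 'M[R]_(n, m)] X).
exists C => Y YL; have [U [V [[UU VV] XE XY]]] := HC Y I YL.
exists (fun x : 'E[R]_n => U^T *m rdiag pos x *m V).
exists (fun Z : euc 'M[R]_(n, m) => mdiag pos (U *m Z *m V^T)).
split => //; split.
- by move=> x Z; exact: frame_dot.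
- by move=> x y; exact: (@frame_dot_frame R n m pos _ GG x y U V (conj UU VV)).
move=> x; have [s ->] := singular_values_perm pos_inj x UU VV.
exact: norm_perm_signed.
Qed.

End singular_value_system.

Section symmetric_system.
Variables (R : realType) (n : nat).
Let V := subvs_of (symmx_space R n).
Let CS := symmetric_chamber_system R n.
Let GG := same_orth_group R n.

Lemma vsval_sym (X : V) : (vsval X)^T = vsval X.
Proof. by apply/eqP; rewrite -symmx_spaceP subvsP. Qed.

Let sym_frame (U : 'M[R]_n) (x : 'E[R]_n) : euc V :=
  vsproj (symmx_space R n) (U^T *m rdiag id x *m U).

Let vsval_frame U x : vsval (sym_frame U x) = U^T *m rdiag id x *m U.
Proof.
apply: vsprojK; rewrite symmx_spaceP; apply/eqP.
by apply: orth_conj_sym; exact: rdiag_sym.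
Qed.

Let norm_vsval (X : euc V) : `|X| = `|vsval X : euc 'M[R]_n|.
Proof. by []. Qed.

Lemma eigen_adapted_frame (X : euc V) (L : R) : exists C, forall Y : euc V, `|Y| <= L ->
  exists U, [/\ U *m U^T = 1%:M, X = sym_frame U (eigenvalues (vsval X)) &
    `|Y - sym_frame U (mdiag id (U *m vsval Y *m U^T))| ^+ 2 <=
      C * (dot (eigenvalues (vsval X)) (eigenvalues (vsval Y)) - dot X Y)].
Proof.
have [C HC] := adapted_frame GG CS L (vsval_sym X).
exists C => Y YL; have [U [_ [[<- UU] XE XY]]] := HC _ (vsval_sym Y) YL.
exists U; split => //; first by apply: val_inj; rewrite [RHS]vsval_frame.
by rewrite norm_vsval linearB /= vsval_frame.
Qed.

Lemma eigen_trace (X Y : euc V) :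
  dot X Y <= dot (eigenvalues (vsval X)) (eigenvalues (vsval Y)).
Proof.
exact: (dot_lam_le GG CS (vsval_sym X) (vsval_sym Y)).
Qed.

Lemma sym_frame_dot U x y : U *m U^T = 1%:M ->
  dot (sym_frame U x) (sym_frame U y) = dot x y.
Proof.
move=> UU; rewrite -[LHS]/(dot (vsval (sym_frame U x)) (vsval (sym_frame U y))).
rewrite !vsval_frame; exact: (@frame_dot_frame R n n id _ GG x y U U (conj erefl UU)).
Qed.

Lemma sym_frame_adj U x (Y : euc V) :
  dot (sym_frame U x) Y = dot x (mdiag id (U *m vsval Y *m U^T)).
Proof.
by rewrite -[LHS]/(dot (vsval (sym_frame U x)) (vsval Y)) vsval_frame frame_dot.
Qed.

Lemma eigenvalue_spectral_system :
  spectral_system (fun X : euc V => eigenvalues (vsval X))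
    (fun s : 'S_n => perm_mx s : 'M[R]_n).
Proof.
split.
- exact: perm_mx_orth.
- exact: eigen_trace.
move=> X L; have [C HC] := eigen_adapted_frame X L.
exists C => Y YL; have [U [UU XE XY]] := HC Y YL.
exists (sym_frame U), (fun Z : euc V => mdiag id (U *m vsval Z *m U^T)).
split => //; split.
- by move=> x Z; exact: sym_frame_adj.
- by move=> x y; exact: sym_frame_dot.
move=> x; rewrite vsval_frame; apply: eigenvalues_perm.
  by apply: orth_conj_sym; exact: rdiag_sym.
by rewrite char_poly_orth_conj// char_poly_rdiag.
Qed.

(** The left-hand side is the inner product of two matrices that are diagonal in a
    common frame and have the singular values of [X] and [Y]. *)
Lemma eigen_singular_dot (X Y : euc V) :
  dot (eigenvalues (vsval X)) (eigenvalues (vsval Y)) <=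
  dot (singular_values (vsval X)) (singular_values (vsval Y)).
Proof.
have [CX HX] := eigen_adapted_frame X `|X|.
have [CY HY] := eigen_adapted_frame Y `|Y|.
have [U [UU XE _]] := HX X (lexx _); have [W [WW YE _]] := HY Y (lexx _).
rewrite -(@sym_frame_dot U)// -XE.
have -> : singular_values (vsval Y) =
    singular_values (vsval (sym_frame U (eigenvalues (vsval Y)))) :> 'E[R]_n.
  rewrite [in LHS]YE !vsval_frame.
  exact: (singular_values_frame (@inj_id _)).
exact: (singular_trace (leqnn n)).
Qed.

(** The eigenvalue frames, reparametrized by the signed permutation that maps
    eigenvalues to singular values: the gap for singular values is at least
    the one for eigenvalues. *)
Lemma symmetric_singular_spectral_system :
  spectral_system (fun X : euc V => singular_values (vsval X))
    (fun pq : ('S_n * {ffun 'I_n -> bool}) * ('S_n * {ffun 'I_n -> bool}) =>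
      signed_perm_mx R pq.1 *m (signed_perm_mx R pq.2)^T).
Proof.
split.
- move=> [p q] /=; apply: orth_mul; first exact: signed_perm_mx_orth.
  by rewrite trmxK; apply: mulmx1C; exact: signed_perm_mx_orth.
- by move=> X Y; exact: (singular_trace (leqnn n)).
move=> X L; have [C HC] := eigen_adapted_frame X L.
exists `|C| => Y YL; have [U [UU XE XY]] := HC Y YL.
have [q qE] : exists q, singular_values (vsval X) =
    signed_perm_mx R q *m eigenvalues (vsval X).
  have [s sE] := singular_values_perm (@inj_id _) (eigenvalues (vsval X)) UU UU.
  have [q qE] := norm_perm_signed (eigenvalues (vsval X)) s.
  by exists q; rewrite -qE -sE -vsval_frame -XE.
pose Q := signed_perm_mx R q.
have QQ : Q *m Q^T = 1%:M := signed_perm_mx_orth R q.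
have QQ' := mulmx1C QQ.
exists (fun x => sym_frame U (Q^T *m x)).
exists (fun Z : euc V => Q *m mdiag id (U *m vsval Z *m U^T)).
split.
- split.
  + by move=> x Z; rewrite sym_frame_adj dot_mulmx_tr trmxK.
  + move=> x y; rewrite sym_frame_dot// dot_mulmx_tr trmxK mulmxA QQ.
    by rewrite mul1mx.
  + move=> x; rewrite vsval_frame.
    have [s ->] := singular_values_perm (@inj_id _) (Q^T *m x) UU UU.
    have [p ->] := norm_perm_signed (Q^T *m x) s.
    by exists (p, q); rewrite mulmxA.
- by rewrite qE mulmxA QQ' mul1mx.
rewrite mulmxA QQ' mul1mx; apply: le_trans XY _.
apply: le_trans (_ : `|C| * (dot (eigenvalues (vsval X)) (eigenvalues (vsval Y))
    - dot X Y) <= _).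
  by rewrite ler_wpM2r ?ler_norm// subr_ge0 eigen_trace.
by rewrite ler_wpM2l// lerD2r eigen_singular_dot.
Qed.

End symmetric_system.

Lemma spectrum_system (R : realType) (s : spectral_setting) :
  exists (I : finType) (Q : I -> 'M[R]_(spec_dim s)),
    spectral_system (@spectrum R s) Q /\
    forall g : 'E[R]_(spec_dim s) -> \bar R, spectral_symmetry g ->
      forall i (x : 'E[R]_(spec_dim s)), g (Q i *m x) = g x.
Proof.
have signed n (p : 'S_n * {ffun 'I_n -> bool}) : is_signed_perm_mx (signed_perm_mx R p).
  by exists (perm_mx p.1), p.2; split => //; exact: perm_mx_is_perm.
case: s => [n m le_nm|n|n].
- exists _, (@signed_perm_mx R n); split; first exact: singular_spectral_system.
  by move=> g gs p x; apply: gs; exact: signed.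
- exists _, (fun pq => signed_perm_mx R pq.1 *m (signed_perm_mx R pq.2)^T).
  split; first exact: symmetric_singular_spectral_system.
  move=> g gs [p q] x /=; rewrite -mulmxA gs; last exact: signed.
  rewrite -(gs _ _ (signed _ q)) mulmxA signed_perm_mx_orth.
  by rewrite mul1mx.
- exists _, (fun s => perm_mx s); split; first exact: eigenvalue_spectral_system.
  by move=> g gs p x; apply: gs; exact: perm_mx_is_perm.
Qed.

(** * The dual problem *)

Section distances.
Variables (R : realType) (V : innerType R).
Implicit Types (x y : euc V) (D : set (euc V)).

Lemma dist_le x y D : D y -> (dist x D <= `|x - y|%:E)%E.
Proof. by move=> Dy; apply: ereal_inf_lbound; exists y. Qed.

Lemma dist_ge0 x D : (0 <= dist x D)%E.
Proof. by apply: le_ereal_inf_tmp => _ [y _ <-]; rewrite lee_fin. Qed.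

Lemma dist_subset x D D' : D `<=` D' -> (dist x D' <= dist x D)%E.
Proof.
by move=> DD'; apply: ereal_inf_le_tmp => _ [y Dy <-]; exists y => //; exact: DD'.
Qed.

End distances.

Section dual_problem.
Variables (R : realType) (X : innerType R) (d e : nat) (P : problem X d e).
Implicit Types (Z : euc (dual_space X d e)) (x : euc X).

Lemma dual_dot Z Z' : dot Z Z' =
  dot (ycomp Z) (ycomp Z') + dot (wcomp Z) (wcomp Z') + dot (Scomp Z) (Scomp Z').
Proof. by []. Qed.

Lemma norm_ycomp Z : `|ycomp Z| <= `|Z|.
Proof. by rewrite !eucnormE ler_wsqrtr// dual_dot -addrA lerDl addr_ge0 ?dot_ge0. Qed.

Lemma norm_wcomp Z : `|wcomp Z| <= `|Z|.
Proof.
by rewrite !eucnormE ler_wsqrtr// dual_dot addrAC lerDr addr_ge0 ?dot_ge0.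
Qed.

Lemma norm_Scomp Z : `|Scomp Z| <= `|Z|.
Proof. by rewrite !eucnormE ler_wsqrtr// dual_dot lerDr addr_ge0 ?dot_ge0. Qed.

Lemma dual_objectiveE Z (a t : R) : dual_cone (pQ P) (ycomp Z) ->
    conjugate (ph P) (- wcomp Z) = a%:E ->
    conjugate (ptheta P) (- Scomp Z) = t%:E ->
  dual_objective P Z = (- dot (pb P) (ycomp Z) + a + t)%:E.
Proof.
move=> yQ ha ta; rewrite /dual_objective ha ta /indicator mem_set//.
by rewrite sub0e -EFinN -!EFinD.
Qed.

Lemma dual_objective_fin Z (c : R) : proper (ph P) -> proper (ptheta P) ->
    dual_cone (pQ P) (ycomp Z) -> (dual_objective P Z <= c%:E)%E ->
  exists a t : R, conjugate (ph P) (- wcomp Z) = a%:E /\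
    conjugate (ptheta P) (- Scomp Z) = t%:E.
Proof.
move=> hp tp yQ; rewrite /dual_objective /indicator mem_set// sub0e -EFinN.
have := conjugate_gtNy (- wcomp Z) hp; have := conjugate_gtNy (- Scomp Z) tp.
by case: (conjugate _ _) => [t| |]//; case: (conjugate _ _) => [a| |]// _ _ _;
  exists a, t.
Qed.

(** The constraint makes the linear terms pair to zero, so the objective differs
    from its value at [Zbar] by the excesses of its three terms over their
    linearizations given by the multiplier [x]. *)
Lemma dual_gap_split x Z Zbar (a a' t t' : R) :
    dual_affine P Z -> dual_affine P Zbar ->
  (- dot (pb P) (ycomp Z) + a + t) - (- dot (pb P) (ycomp Zbar) + a' + t') =
    - dot (pb P - pA P x) (ycomp Z - ycomp Zbar)
    + (a - a' - dot (pF P x) (- wcomp Z - - wcomp Zbar))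
    + (t - t' - dot x (- Scomp Z - - Scomp Zbar)).
Proof.
move=> /(congr1 (dot x)) + /(congr1 (dot x)).
rewrite !dotDr -!(pA_adjoint P) -!(pF_adjoint P) => <-.
by rewrite !(dotBl, dotBr, dotNr); lra.
Qed.

(** At such a point the three excesses of [dual_gap_split] are at most zero. For the
    last one, a subgradient of [ptheta P] at [x] attains equality in the
    Fenchel-Young inequality. *)
Lemma multiplier_solution x Z Zbar :
    proper (ph P) -> proper (ptheta P) ->
    dual_solutions P Zbar -> dual_multipliers P Zbar x ->
    dual_affine P Z -> G1 P x Z -> G2 (wcomp Zbar) Z -> G3 P x Z ->
  dual_solutions P Z.
Proof.
move=> hp tp [Zaff Zfin Zmin] [[ybarD Ny] subh subt _] Zaff' [yD NZ] wE subS.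
have {}wE : wcomp Z = wcomp Zbar := wE.
have obj_le : (dual_objective P Zbar <= (fine (dual_objective P Zbar))%:E)%E.
  by rewrite fineK.
have [a [t [ha ta]]] := dual_objective_fin hp tp ybarD obj_le.
have [u thx] := subdifferential_fin tp subS.
have tZ := conjugate_of_subdifferential tp thx subS.
have haZ : conjugate (ph P) (- wcomp Z) = a%:E by rewrite wE.
have objZ := dual_objectiveE yD haZ tZ.
have objZbar := dual_objectiveE ybarD ha ta.
split => //; first by rewrite objZ.
move=> Z' Z'aff; apply: le_trans (Zmin _ Z'aff).
rewrite objZ objZbar lee_fin -subr_le0 (dual_gap_split x _ _ _ _ Zaff' Zaff).
have /= := fenchel_young_fin (- Scomp Zbar) thx; rewrite ta lee_fin.
have := NZ _ ybarD; rewrite wE !subrr dot0r.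
by rewrite !(dotBr, dotNr); lra.
Qed.

End dual_problem.

Section growth_of_the_dual.
Variables (R : realType) (X : innerType R) (d e : nat) (P : problem X d e).
Implicit Types (Z : euc (dual_space X d e)) (x : euc X).
Variables (Zbar : euc (dual_space X d e)) (Xbar : euc X).
Hypothesis h_proper : proper (ph P).
Hypothesis theta_proper : proper (ptheta P).
Hypothesis Zbar_opt : dual_solutions P Zbar.
Hypothesis Xbar_mult : dual_multipliers P Zbar Xbar.

Lemma norm_replace_ycomp Z (z : 'E[R]_e) :
  `|Z - ((z, wcomp Z, Scomp Z) : euc (dual_space X d e))| = `|ycomp Z - z|.
Proof.
rewrite !eucnormE; congr Num.sqrt.
transitivity (dot (ycomp Z - z) (ycomp Z - z) + dot (wcomp Z - wcomp Z) (wcomp Z - wcomp Z) + dot (Scomp Z - Scomp Z) (Scomp Z - Scomp Z)) => //.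
by rewrite !subrr !dot0r !addr0.
Qed.

Lemma norm_replace_wcomp Z (w : 'E[R]_d) :
  `|Z - ((ycomp Z, w, Scomp Z) : euc (dual_space X d e))| = `|wcomp Z - w|.
Proof.
rewrite !eucnormE; congr Num.sqrt.
transitivity (dot (ycomp Z - ycomp Z) (ycomp Z - ycomp Z) + dot (wcomp Z - w) (wcomp Z - w) + dot (Scomp Z - Scomp Z) (Scomp Z - Scomp Z)) => //.
by rewrite !subrr !dot0r addr0 add0r.
Qed.

Lemma norm_replace_Scomp Z (S : euc X) :
  `|Z - ((ycomp Z, wcomp Z, S) : euc (dual_space X d e))| = `|Scomp Z - S|.
Proof.
rewrite !eucnormE; congr Num.sqrt.
transitivity (dot (ycomp Z - ycomp Z) (ycomp Z - ycomp Z) + dot (wcomp Z - wcomp Z) (wcomp Z - wcomp Z) + dot (Scomp Z - S) (Scomp Z - S)) => //.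
by rewrite !subrr !dot0r !add0r.
Qed.

(** The excess of the objective at [Z] bounds each of the three nonnegative
    excesses of [dual_gap_split], hence the squared distances from [Z] to the
    sets of the collection; bounded linear regularity turns these into a bound on
    the distance to their intersection, which consists of solutions. *)
Lemma quadratic_growth_of_excess_growth (eps1 eps2 eps3 : R) :
    0 < eps1 -> 0 < eps2 -> 0 < eps3 ->
    (forall y r, dual_cone (pQ P) y -> `|y - ycomp Zbar| <= eps1 ->
      - dot (pb P - pA P Xbar) (y - ycomp Zbar) <= r ->
      exists2 z, normal_cone (dual_cone (pQ P)) z (pb P - pA P Xbar) &
        eps1 * `|y - z| ^+ 2 <= r) ->
    (forall a w r, conjugate (ph P) (- wcomp Zbar) = a%:E ->
      `|w - - wcomp Zbar| <= eps2 ->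
      (conjugate (ph P) w <= (a + dot (pF P Xbar) (w - - wcomp Zbar) + r)%:E)%E ->
      eps2 * `|w - - wcomp Zbar| ^+ 2 <= r) ->
    (forall t S r, conjugate (ptheta P) (- Scomp Zbar) = t%:E ->
      `|S - - Scomp Zbar| <= eps3 ->
      (conjugate (ptheta P) S <= (t + dot Xbar (S - - Scomp Zbar) + r)%:E)%E ->
      exists2 W, subdifferential (ptheta P) Xbar W & eps3 * `|S - W| ^+ 2 <= r) ->
    boundedly_linearly_regular
      [tuple dual_affine P; G1 P Xbar; G2 (wcomp Zbar); G3 P Xbar] ->
  exists delta kappa : R, [/\ 0 < delta, 0 < kappa &
    forall Z, dual_feasible P Z -> closed_ball Zbar delta Z ->
      (dual_objective P Zbar + kappa%:E * dist Z (dual_solutions P) ^+ 2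
         <= dual_objective P Z)%E].
Proof.
move=> e1 e2 e3 grow1 grow2 grow3 [_ _ _ regular].
have [Zaff Zfin _] := Zbar_opt.
have [[ybarD Ny] subh subt _] := Xbar_mult.
have obj_le : (dual_objective P Zbar <= (fine (dual_objective P Zbar))%:E)%E.
  by rewrite fineK.
have [a0 [t0 [ha0 ta0]]] := dual_objective_fin h_proper theta_proper ybarD obj_le.
have [kappa kappa0 Hreg] : exists2 kappa : R, 0 < kappa & forall Z, `|Zbar - Z| <= 1 ->
    (dist Z (\bigcap_(i in [set: 'I_4]) tnth
       [tuple dual_affine P; G1 P Xbar; G2 (wcomp Zbar); G3 P Xbar] i) <=
     kappa%:E * \big[maxe/0]_(i < 4) dist Z (tnth
       [tuple dual_affine P; G1 P Xbar; G2 (wcomp Zbar); G3 P Xbar] i))%E.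
  have [|kappa kappa0 H] := regular [set Z | `|Zbar - Z| <= 1].
    exists (`|Zbar| + 1); split; first exact: num_real.
    move=> M ltM Z /= ZB; apply: le_trans (ltW ltM).
    by rewrite -[Z](subrKC Zbar) (le_trans (ler_normD _ _))// lerD2l distrC.
  by exists kappa.
pose delta := Num.min 1 (Num.min eps1 (Num.min eps2 eps3)).
have delta0 : 0 < delta by rewrite !lt_min ltr01 e1 e2 e3.
pose K := eps1^-1 + eps2^-1 + eps3^-1.
have [i1 i2 i3] : [/\ 0 < eps1^-1, 0 < eps2^-1 & 0 < eps3^-1] by rewrite !invr_gt0.
have K0 : 0 < K by rewrite !addr_gt0.
exists delta, (kappa ^+ 2 * K)^-1; split => //.
  by rewrite invr_gt0 mulr_gt0// exprn_gt0.
move=> Z [Zaff' yD]; rewrite closed_ball_eucE//= !le_min => /and4P[Z1 Ze1 Ze2 Ze3].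
have [objinf|] := eqVneq (dual_objective P Z) +oo%E; first by rewrite objinf leey.
move=> objfin; have [c objc] : exists c : R, (dual_objective P Z <= c%:E)%E.
  case: (dual_objective P Z) objfin => [c _|/eqP//|_]; first by exists c.
  by exists 0; rewrite leNye.
have [a [t [ha ta]]] := dual_objective_fin h_proper theta_proper yD objc.
rewrite (dual_objectiveE yD ha ta) (dual_objectiveE ybarD ha0 ta0).
set obj := - _ + a + t; set obj0 := - _ + a0 + t0.
pose r := obj - obj0.
have rE := dual_gap_split Xbar a a0 t t0 Zaff' Zaff; rewrite -/obj -/obj0 -/r in rE.
pose T1 := - dot (pb P - pA P Xbar) (ycomp Z - ycomp Zbar).
pose T2 := a - a0 - dot (pF P Xbar) (- wcomp Z - - wcomp Zbar).
pose T3 := t - t0 - dot Xbar (- Scomp Z - - Scomp Zbar).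
have T10 : 0 <= T1 by rewrite oppr_ge0 Ny.
have T20 : 0 <= T2.
  by have := subh (- wcomp Z); rewrite ha ha0 -EFinD lee_fin /T2; lra.
have T30 : 0 <= T3.
  by have := subt (- Scomp Z); rewrite ta ta0 -EFinD lee_fin /T3; lra.
have {}rE : r = T1 + T2 + T3 := rE.
have r0 : 0 <= r by rewrite rE; lra.
pose rho := Num.sqrt (K * r).
have rho2 : rho ^+ 2 = K * r by rewrite sqr_sqrtr// mulr_ge0// ltW.
have le_rho (eps u : R) : 0 < eps -> eps^-1 <= K -> 0 <= u -> eps * u ^+ 2 <= r -> u <= rho.
  move=> eps0 epsK u0 epsu; rewrite -ler_sqr ?nnegrE ?sqrtr_ge0// rho2.
  apply: (@le_trans _ _ (eps^-1 * r)); last by rewrite ler_wpM2r.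
  by rewrite ler_pdivlMl.
have rho0 : 0 <= rho by exact: sqrtr_ge0.
have dist1 : (dist Z (G1 P Xbar) <= rho%:E)%E.
  have [||z Nz zr] := grow1 (ycomp Z) r yD.
  - apply: le_trans Ze1; rewrite distrC; exact: (norm_ycomp (Zbar - Z)).
  - by rewrite -/T1 rE -addrA lerDl addr_ge0.
  apply: le_trans (dist_le Z (_ : G1 P Xbar (z, wcomp Z, Scomp Z))) _ => //.
  rewrite norm_replace_ycomp lee_fin; apply: (le_rho eps1) => //.
  by rewrite /K -addrA lerDl addr_ge0 ?ltW.
have dist2 : (dist Z (G2 (wcomp Zbar)) <= rho%:E)%E.
  have wr : eps2 * `|- wcomp Z - - wcomp Zbar| ^+ 2 <= r.
    apply: (grow2 a0) => //.
      by rewrite opprK addrC; apply: le_trans Ze2; exact: (norm_wcomp (Zbar - Z)).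
    by rewrite ha lee_fin rE; move: T10 T30; rewrite /T2; lra.
  apply: le_trans (dist_le Z (_ : G2 (wcomp Zbar) (ycomp Z, wcomp Zbar, Scomp Z))) _ => //.
  rewrite norm_replace_wcomp lee_fin; apply: (le_rho eps2) => //.
    by rewrite /K addrAC lerDr addr_ge0 ?ltW.
  by move: wr; rewrite opprK addrC distrC.
have dist3 : (dist Z (G3 P Xbar) <= rho%:E)%E.
  have [||W subW Wr] := grow3 t0 (- Scomp Z) r ta0.
  - by rewrite opprK addrC; apply: le_trans Ze3; exact: (norm_Scomp (Zbar - Z)).
  - by rewrite ta lee_fin rE; move: T10 T20; rewrite /T3; lra.
  apply: le_trans (dist_le Z (_ : G3 P Xbar (ycomp Z, wcomp Z, - W))) _.
    by rewrite /G3 /Scomp /= opprK.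
  rewrite norm_replace_Scomp lee_fin; apply: (le_rho eps3) => //.
    by rewrite /K lerDr addr_ge0 ?ltW.
  by move: Wr; rewrite opprK -opprD normrN.
have dist0 : (dist Z (dual_affine P) <= rho%:E)%E.
  by apply: le_trans (dist_le Z Zaff') _; rewrite subrr normr0 lee_fin.
have distI : (dist Z (dual_solutions P) <= (kappa * rho)%:E)%E.
  apply: le_trans (_ : (kappa%:E * rho%:E <= _)%E); last by rewrite EFinM.
  apply: le_trans (le_trans (Hreg Z Z1) _).
    apply: dist_subset => Z' HZ'.
    apply: (multiplier_solution h_proper theta_proper Zbar_opt Xbar_mult).
    - by have := HZ' (inord 0) I; rewrite (tnth_nth set0) inordK.
    - by have := HZ' (inord 1) I; rewrite (tnth_nth set0) inordK.
    - by have := HZ' (inord 2) I; rewrite (tnth_nth set0) inordK.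
    - by have := HZ' (inord 3) I; rewrite (tnth_nth set0) inordK.
  rewrite lee_pmul2l ?lte_fin//.
  elim/big_ind : _ => [|u v ur vr|i _]; first by rewrite lee_fin.
    by rewrite ge_max ur vr.
  rewrite (tnth_nth set0); case: i => [[|[|[|[|]]]] //].
have := dist_ge0 Z (dual_solutions P).
case: (dist Z _) distI => [u| |]//; rewrite !lee_fin => ur u0.
rewrite -expr2 -lerBrDl -/r.
rewrite ler_pdivrMl ?mulr_gt0 ?exprn_gt0//.
apply: (@le_trans _ _ ((kappa * rho) ^+ 2)).
  by rewrite lerXn2r ?nnegrE// mulr_ge0// ltW.
by rewrite exprMn rho2 mulrA.
Qed.

End growth_of_the_dual.

Unset Implicit Arguments.

Theorem theorem18 (R : realType) (s : spectral_setting) (d e : nat)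
    (P : problem (matrix_space R s) d e)
    (g : 'E[R]_(spec_dim s) -> \bar R)
    (Zbar : euc (dual_space (matrix_space R s) d e))
    (h_gtNy : forall u, ph P u != -oo%E)
    (h_convex : econvex (ph P))
    (h_C1 : C1_on_open_convex_dom (ph P))
    (theta_ccp : closed_convex_proper (ptheta P))
    (Q_polyhedral : polyhedral_cone (pQ P))
    (primal_solvable : primal_solutions P !=set0)
    (dual_solvable : dual_solutions P !=set0)
    (g_ccp : closed_convex_proper g)
    (g_sym : spectral_symmetry g)
    (theta_spectral : ptheta P = g \o @spectrum R s)
    (Zbar_optimal : dual_solutions P Zbar)
    (Zbar_multiplier : dual_multipliers P Zbar !=set0)
    (hconj_C1 : C1_on_open_convex_dom (conjugate (ph P)))
    (hconj_strongly_convex : strongly_convex_on_compacts (conjugate (ph P)))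
    (gconj_subregular :
      forall v, subdifferential (conjugate g) (spectrum (- Scomp Zbar)) v ->
        metrically_subregular (subdifferential (conjugate g))
          (spectrum (- Scomp Zbar)) v)
    (regular_collection : exists2 Xbar, dual_multipliers P Zbar Xbar &
      boundedly_linearly_regular
        [tuple dual_affine P; G1 P Xbar; G2 (wcomp Zbar); G3 P Xbar]) :
  exists delta kappa : R,
    [/\ 0 < delta, 0 < kappa &
        forall Z, dual_feasible P Z -> closed_ball Zbar delta Z ->
          (dual_objective P Zbar + kappa%:E * dist Z (dual_solutions P) ^+ 2
             <= dual_objective P Z)%E].
Proof.
have [h_dom _ _ _] := h_C1; have h_proper : proper (ph P) by split.
have [theta_proper _ _] := theta_ccp; have [g_proper _ _] := g_ccp.
have [_ hconj_open _ _] := hconj_C1.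
have [Xbar mult regular] := regular_collection.
have [Ny subh subt _] := mult; have [_ _ [Z0 HZ0] _] := regular.
have subZ0 : subdifferential (ptheta P) Xbar (- Scomp Z0).
  by have := HZ0 (inord 3) I; rewrite (tnth_nth set0) inordK.
have [_ Zfin _] := Zbar_optimal.
have obj_le : (dual_objective P Zbar <= (fine (dual_objective P Zbar))%:E)%E.
  by rewrite fineK.
have [a0 [t0 [ha0 ta0]]] := dual_objective_fin h_proper theta_proper (proj1 Ny) obj_le.
have [eps1 e1 grow1] := polyhedral_normal_cone_growth Q_polyhedral Ny.
have [eps2 e2 grow2] := strongly_convex_growth hconj_open hconj_strongly_convex ha0 subh.
have [I [Q [sys symQ]]] := spectrum_system R s.
have [eps3 e3 grow3] : exists2 eps : R, 0 < eps & forall S r,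
    `|S - - Scomp Zbar| <= eps ->
    (conjugate (ptheta P) S <= (t0 + dot Xbar (S - - Scomp Zbar) + r)%:E)%E ->
    exists2 W, subdifferential (ptheta P) Xbar W & eps * `|S - W| ^+ 2 <= r.
  move: theta_proper subZ0 ta0 subt; rewrite theta_spectral => th_proper sub0 ta0 subt.
  exact: (spectral_growth sys g_proper (symQ g g_sym) th_proper sub0 ta0 subt gconj_subregular).
apply: (quadratic_growth_of_excess_growth h_proper theta_proper Zbar_optimal mult
  e1 e2 e3 grow1 _ _ regular).
  by move=> a w r; rewrite ha0 => -[<-]; exact: grow2.
by move=> t S r; rewrite ta0 => -[<-]; exact: grow3.
Qed.
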